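(* Let $0<\lambda\le\frac{1}{23.46}$. Consider asynchronous tatonnement with update rule $p_j^{t+}=p_j^t\big(1+\lambda\min\{\tilde z_j,1\}(t-\tau_j)\big)$ starting from strictly positive prices. (i) If every buyer has a complementary-CES utility function, then the prices converge to the market equilibrium. (ii) If every buyer has a Leontief utility function, then the prices converge toward the set of market equilibria: every limit point of the price trajectory $(p^t)_{t\ge0}$ is a market equilibrium.
   Context: A Fisher market has $n$ goods, each with supply $1$, and buyers $i$ with budgets $e_i>0$ and utility functions $u_i$. At prices $p\ge0$, buyer $i$ demands a utility-maximizing bundle $(x_{ij}(p))_j$ of cost at most $e_i$; the demand for good $j$ is $x_j(p)=\sum_ix_{ij}(p)$ and the excess demand is $z_j(p)=x_j(p)-1$. Prices $p^*$ form a market equilibrium if $z_j(p^* )=0$ whenever $p^*_j>0$ and $z_j(p^* )\le0$ whenever $p^*_j=0$. A complementary-CES utility is $u_i(x)=(\sum_ja_{ij}x_{ij}^{\rho_i})^{1/\rho_i}$ with $\rho_i\le 0$ and $a_{ij}\ge0$. A Leontief utility is $u_i(x)=\min_{j\in S_i}b_{ij}x_{ij}$ for a nonempty set $S_i$ of goods and $b_{ij}>0$. Asynchronous tatonnement: time $t\ge0$ is continuous; each price $p_j$ is changed only at discrete update times, no two updates occur simultaneously, and consecutive updates to the same price are at most one time unit apart; $p^t$ denotes current prices just before any update at time $t$ and $p_j^{t+}$ the value just after. At an update to $p_j$ at time $t$, $\tau_j$ is the time of the previous update to $p_j$ ($0$ if none), and $\tilde z_j$ is any value between the minimum and maximum of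 the excess demands $z_j(p^{t'})$ over $t'\in(\tau_j,t]$. *)

(* Defs.v *)
From Stdlib Require Import Reals.
Open Scope R_scope.

(* Goods are indexed by j < n, buyers by i < m.  Price vectors, bundles
   are functions nat -> R; only indices j < n are meaningful. *)

Fixpoint rsum (n : nat) (f : nat -> R) : R :=
  match n with O => 0 | S k => rsum k f + f k end.

Fixpoint rprod (n : nat) (f : nat -> R) : R :=
  match n with O => 1 | S k => rprod k f * f k end.

Fixpoint starved (n : nat) (a x : nat -> R) : bool :=
  match n with
  | O => false
  | S k => orb (starved k a x)
              (if Rlt_dec 0 (a k) then (if Rle_dec (x k) 0 then true else false)
               else false)
  end.

(* Complementary-CES utility (sum_j a_j x_j^rho)^(1/rho), rho <= 0.
   rho < 0: terms with a_j = 0 contribute 0; if some desired good (a_j > 0)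
   has x_j = 0 the value is the limit value 0.
   rho = 0: the Cobb-Douglas limit prod_j x_j^(a_j). *)
Definition ces_util (n : nat) (a : nat -> R) (rho : R) (x : nat -> R) : R :=
  if starved n a x then 0 else
  if Rlt_dec rho 0 then
    Rpower (rsum n (fun j => if Rlt_dec 0 (a j) then a j * Rpower (x j) rho else 0))
           (1 / rho)
  else
    rprod n (fun j => if Rlt_dec 0 (a j) then Rpower (x j) (a j) else 1).

Fixpoint min_over (n : nat) (A : nat -> bool) (f : nat -> R) : option R :=
  match n with
  | O => None
  | S k =>
    let r := min_over k A f in
    if A k then
      match r with None => Some (f k) | Some v => Some (Rmin v (f k)) end
    else r
  end.

Definition leontief_util (n : nat) (A : nat -> bool) (b : nat -> R) (x : nat -> R) : R :=
  match min_over n A (fun j => b j * x j) with Some v => v | None => 0 end.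

Definition IsDemand (n : nat) (u : (nat -> R) -> R) (e : R) (p x : nat -> R) : Prop :=
  (forall j, (j < n)%nat -> 0 <= x j) /\
  rsum n (fun j => p j * x j) <= e /\
  (forall y, (forall j, (j < n)%nat -> 0 <= y j) ->
     rsum n (fun j => p j * y j) <= e -> u y <= u x).

Definition IsEquilibrium (n m : nat) (e : nat -> R) (u : nat -> (nat -> R) -> R)
    (q : nat -> R) : Prop :=
  (forall j, (j < n)%nat -> 0 <= q j) /\
  exists x : nat -> nat -> R,
    (forall i, (i < m)%nat -> IsDemand n (u i) (e i) q (x i)) /\
    (forall j, (j < n)%nat ->
       (0 < q j -> rsum m (fun i => x i j) - 1 = 0) /\
       (q j = 0 -> rsum m (fun i => x i j) - 1 <= 0)).

Definition excess (m : nat) (D : nat -> (nat -> R) -> nat -> R) (q : nat -> R) (j : nat) : R :=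
  rsum m (fun i => D i q j) - 1.

(* time of the update preceding the k-th update of good j (0 if none) *)
Definition prev_time (T : nat -> nat -> R) (j k : nat) : R :=
  match k with O => 0 | S k' => T j k' end.

(* Main.v *)
Require Import Defs.
From Stdlib Require Import Reals Lra Lia Classical ClassicalEpsilon Wf_nat.
Open Scope R_scope.

(** Every demand in question has the form [e w_j p_j^(-c) / sum_k w_k p_k^(1-c)] with [0 <= c <= 1]:
    [c = 1/(1-rho)], [w = a^c] for CES utilities, and [c = 0], [w = 1/b] for Leontief utilities.
    It is minus the gradient of a convex potential, so an update of [p_j] along the true excess demand
    decreases [phi(p)], the sum of the prices and of the buyers' potentials.  The signal is outdated only
    because of updates of other prices within the last epoch of [p_j]; the resulting error is bilinear in
    the two relative changes, with coefficients whose sums against the prices are bounded by spending.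
    By AM-GM it is split between the two updates, and half of it is stored in [pending] until the next
    update of [p_j].  For small [lambda] the amortised potential decreases by at least
    [lambda/2 * p_j * gap * min(z,1)^2] per update; summability of these terms makes the prices vary slowly,
    and every limit point clears the market for each good of positive price.

    For [c > 0] the prices of wanted goods stay bounded away from [0] and strict convexity makes the limit
    point unique.  For [c = 0] the demands at a limit point depend only on its support, so they take
    finitely many values; a good with price [0] and excess demand would give, by slow variation, limit
    points at all intermediate demand levels. *)


(** * Finite sums, logarithms and powers *)

(** Convexity is used with the gradient at the prices after the update, so a step has no
    second-order term of its own: the whole error is the distance from the demand after the update
    to the signal. After amortisation this error is at most [33/8 * lambda * d^2 * x] against a gain
    [z * d], where [z] is the signal, [d = min(z,1)] and [x] is the current demand. Clipping makes
    the two comparable: [x <= 11/10 * (1 + z)], so [x] is bounded for [z <= 1], while for [z > 1]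
    one has [d = 1] and both sides grow linearly in [z]. Since [11/10 * 33/8 / 23.46 < 1/5], the
    error is below [(1 + z) * d^2 / 5], which leaves [d^2 / 2] of the gain.

    Two obstacles concern small prices. A demand function is pinned down only at positive prices, so
    positivity of the trajectory has to be proved together with the bounds on the signals. And
    Leontief prices may tend to 0; what stays away from 0 is the cost of each buyer's bundle,
    because [phi] never exceeds its initial value. *)

Lemma rsum_ext n f g : (forall j, (j < n)%nat -> f j = g j) -> rsum n f = rsum n g.
Proof.
  induction n as [|n IH]; intros H; simpl; [reflexivity|].
  rewrite IH, H; auto with arith.
Qed.

Lemma rsum_le n f g : (forall j, (j < n)%nat -> f j <= g j) -> rsum n f <= rsum n g.
Proof.
  induction n as [|n IH]; intros H; simpl; [lra|].
  apply Rplus_le_compat; auto with arith.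
Qed.

Lemma rsum_zero n : rsum n (fun _ => 0) = 0.
Proof. induction n as [|n IH]; simpl; [reflexivity|]. rewrite IH; lra. Qed.

Lemma rsum_nonneg n f : (forall j, (j < n)%nat -> 0 <= f j) -> 0 <= rsum n f.
Proof. intros H. rewrite <- (rsum_zero n). apply rsum_le, H. Qed.

Lemma rsum_plus n f g : rsum n (fun j => f j + g j) = rsum n f + rsum n g.
Proof. induction n as [|n IH]; simpl; [lra|]. rewrite IH; lra. Qed.

Lemma rsum_scal n a f : rsum n (fun j => a * f j) = a * rsum n f.
Proof. induction n as [|n IH]; simpl; [lra|]. rewrite IH; lra. Qed.

Lemma rsum_minus n f g : rsum n (fun j => f j - g j) = rsum n f - rsum n g.
Proof. induction n as [|n IH]; simpl; [lra|]. rewrite IH; lra. Qed.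

Lemma rsum_swap n m (f : nat -> nat -> R) :
  rsum n (fun i => rsum m (fun j => f i j)) = rsum m (fun j => rsum n (fun i => f i j)).
Proof.
  induction n as [|n IH]; simpl; [now rewrite rsum_zero|].
  now rewrite IH, rsum_plus.
Qed.

Lemma rsum_term_le n f k :
  (forall j, (j < n)%nat -> 0 <= f j) -> (k < n)%nat -> f k <= rsum n f.
Proof.
  induction n as [|n IH]; intros H Hk; [lia|]; simpl.
  assert (0 <= rsum n f) by (apply rsum_nonneg; auto with arith).
  assert (0 <= f n) by auto with arith.
  destruct (Nat.eq_dec k n) as [->|Hne]; [lra|].
  assert (f k <= rsum n f) by (apply IH; [auto with arith|lia]). lra.
Qed.

Lemma rsum_pos n f k :
  (forall j, (j < n)%nat -> 0 <= f j) -> (k < n)%nat -> 0 < f k -> 0 < rsum n f.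
Proof. intros H Hk Hf. pose proof (rsum_term_le n f k H Hk). lra. Qed.

Lemma rsum_nonneg_eq0 n f :
  (forall j, (j < n)%nat -> 0 <= f j) -> rsum n f <= 0 ->
  forall j, (j < n)%nat -> f j = 0.
Proof.
  intros H Hs j Hj. pose proof (rsum_term_le n f j H Hj). pose proof (H j Hj). lra.
Qed.

Lemma rsum_update n f g k :
  (k < n)%nat -> (forall j, (j < n)%nat -> j <> k -> g j = f j) ->
  rsum n g = rsum n f + (g k - f k).
Proof.
  induction n as [|n IH]; intros Hk H; [lia|]; simpl.
  destruct (Nat.eq_dec k n) as [->|Hne].
  - rewrite (rsum_ext n g f); [lra|]. intros j Hj; apply H; lia.
  - rewrite IH; [|lia|intros; apply H; lia]. rewrite (H n); [lra|lia|lia].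
Qed.

Lemma rsum_abs_le n f : Rabs (rsum n f) <= rsum n (fun j => Rabs (f j)).
Proof.
  induction n as [|n IH]; simpl; [rewrite Rabs_R0; lra|].
  eapply Rle_trans; [apply Rabs_triang|lra].
Qed.

Lemma ln_le_minus_1 r : 0 < r -> ln r <= r - 1.
Proof.
  intros H. pose proof (exp_ineq1_le (ln r)) as E. rewrite exp_ln in E by assumption. lra.
Qed.

Lemma ln_lt_minus_1 r : 0 < r -> r <> 1 -> ln r < r - 1.
Proof.
  intros H H1. pose proof (exp_ineq1 (ln r) (ln_neq_0 r H1 H)) as E.
  rewrite exp_ln in E by assumption. lra.
Qed.

Lemma ln_le x y : 0 < x -> x <= y -> ln x <= ln y.
Proof.
  intros Hx [H| ->]; [|lra]. left; now apply ln_increasing.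
Qed.

Lemma Rpower_pos x y : 0 < Rpower x y.
Proof. apply exp_pos. Qed.

(** Concavity of [ln], through its tangent at [m]: the bounds for [ln (r / m)] and [ln (1 / m)],
    weighted by [th] and [1 - th], have right-hand sides that cancel, and the first bound is
    strict. *)
Lemma Rpower_bernoulli_strict r th :
  0 < r -> r <> 1 -> 0 < th < 1 -> Rpower r th < 1 + th * (r - 1).
Proof.
  intros Hr Hr1 Hth.
  assert (Hm : 0 < 1 + th * (r - 1)) by nra.
  set (m := 1 + th * (r - 1)) in *.
  assert (H1 : ln (r / m) < r / m - 1).
  { apply ln_lt_minus_1; [apply Rdiv_lt_0_compat; lra|]. intros E.
    assert (E2 : r = m) by (rewrite <- (Rmult_1_l m), <- E; field; lra).
    assert (E3 : (1 - th) * (r - 1) = 0) by (unfold m in E2; lra).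
    apply Rmult_integral in E3. lra. }
  assert (H2 : ln (1 / m) <= 1 / m - 1) by (apply ln_le_minus_1, Rdiv_lt_0_compat; lra).
  unfold Rdiv in H1, H2.
  rewrite ln_mult, ln_Rinv in H1 by (auto using Rinv_0_lt_compat).
  rewrite ln_mult, ln_Rinv, ln_1 in H2 by (auto using Rinv_0_lt_compat; lra).
  assert (E : th * (r * / m - 1) + (1 - th) * (1 * / m - 1) = 0) by (unfold m in *; field; lra).
  unfold Rpower. rewrite <- (exp_ln m Hm). apply exp_increasing. nra.
Qed.

Lemma Rpower_bernoulli r th :
  0 < r -> 0 <= th <= 1 -> Rpower r th <= 1 + th * (r - 1).
Proof.
  intros Hr Hth.
  destruct (Req_dec r 1) as [->|H1]; [unfold Rpower; rewrite ln_1, Rmult_0_r, exp_0; lra|].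
  destruct (Req_dec th 0) as [->|H2]; [rewrite Rpower_O by auto; lra|].
  destruct (Req_dec th 1) as [->|H3]; [rewrite Rpower_1 by auto; lra|].
  left. apply Rpower_bernoulli_strict; lra.
Qed.

Lemma Rpower_base1 y : Rpower 1 y = 1.
Proof. unfold Rpower. rewrite ln_1, Rmult_0_r. apply exp_0. Qed.

Lemma Rpower_ge1 r th : 1 <= r -> 0 <= th -> 1 <= Rpower r th.
Proof. intros. rewrite <- (Rpower_base1 th). apply Rle_Rpower_l; lra. Qed.

Lemma Rpower_le1 r th : 0 < r <= 1 -> 0 <= th -> Rpower r th <= 1.
Proof. intros. rewrite <- (Rpower_base1 th). apply Rle_Rpower_l; lra. Qed.

Lemma Rpower_ge_base r th : 0 < r <= 1 -> 0 <= th <= 1 -> r <= Rpower r th.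
Proof.
  intros Hr Hth.
  assert (Rpower (/ r) th <= / r).
  { assert (1 <= / r) by (rewrite <- Rinv_1; apply Rinv_le_contravar; lra).
    eapply Rle_trans; [apply Rpower_bernoulli; lra|nra]. }
  assert (E : Rpower (/ r) th * Rpower r th = 1).
  { rewrite Rpower_mult_distr by (try apply Rinv_0_lt_compat; lra).
    rewrite Rinv_l by lra. apply Rpower_base1. }
  pose proof (Rpower_pos r th). pose proof (Rpower_pos (/ r) th).
  assert (Rpower (/ r) th * r <= 1).
  { rewrite <- (Rinv_l r) by lra. apply Rmult_le_compat_r; lra. }
  nra.
Qed.

Lemma Rpower_dist1 f th : -1 < f -> 0 <= th <= 1 -> Rabs (Rpower (1 + f) th - 1) <= Rabs f.
Proof.
  intros Hf Hth. destruct (Rle_dec 0 f) as [H|H].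
  - pose proof (Rpower_ge1 (1 + f) th ltac:(lra) ltac:(lra)).
    pose proof (Rpower_bernoulli (1 + f) th ltac:(lra) ltac:(lra)).
    rewrite !Rabs_pos_eq by lra. nra.
  - pose proof (Rpower_le1 (1 + f) th ltac:(lra) ltac:(lra)).
    pose proof (Rpower_ge_base (1 + f) th ltac:(lra) ltac:(lra)).
    rewrite !Rabs_left1 by lra. lra.
Qed.

Lemma Rpower_opp_mult p c : 0 < p -> p * Rpower p (- c) = Rpower p (1 - c).
Proof.
  intros Hp. rewrite <- (Rpower_1 p Hp) at 1. rewrite <- Rpower_plus. f_equal; lra.
Qed.

Lemma Rpower_ratio p p' r th :
  0 < p -> 0 < p' -> 1 <= r -> p' <= r * p -> 0 <= th <= 1 ->
  Rpower p' th <= r * Rpower p th.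
Proof.
  intros Hp Hp' Hr H Hth.
  eapply Rle_trans; [apply (Rle_Rpower_l p' (r * p) th); lra|].
  rewrite <- Rpower_mult_distr by lra.
  apply Rmult_le_compat_r; [left; apply Rpower_pos|].
  eapply Rle_trans; [apply Rpower_bernoulli; lra|]. nra.
Qed.

(** * Demand and potential of a single buyer *)

Section Buyer.
Variables (n : nat) (w : nat -> R) (c e : R).
Hypothesis Hc : 0 <= c <= 1.
Hypothesis Hw : forall j, (j < n)%nat -> 0 <= w j.
Hypothesis Hwpos : exists j, (j < n)%nat /\ 0 < w j.
Hypothesis He : 0 < e.

Definition priceIndex (p : nat -> R) : R :=
  rsum n (fun k => w k * Rpower (p k) (1 - c)).

Definition demand (p : nat -> R) (j : nat) : R :=
  e * (w j * Rpower (p j) (- c)) / priceIndex p.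

Definition wantedPos (p : nat -> R) : Prop :=
  forall j, (j < n)%nat -> 0 < w j -> 0 < p j.

(** Valid even at zero prices: [Rpower] is an exponential, so a wanted good always contributes a
    positive term. Genuine power laws enter with [spending_eq], hence [wantedPos] there. *)
Lemma priceIndex_pos p : 0 < priceIndex p.
Proof.
  destruct Hwpos as [k [Hk Hwk]]. apply rsum_pos with k; auto.
  - intros j Hj. apply Rmult_le_pos; [auto|left; apply Rpower_pos].
  - apply Rmult_lt_0_compat; [auto|apply Rpower_pos].
Qed.

Lemma demand_nonneg p j : (j < n)%nat -> 0 <= demand p j.
Proof.
  intros Hj. unfold demand, Rdiv. pose proof (priceIndex_pos p) as HS.
  pose proof (Rpower_pos (p j) (- c)). apply Rinv_0_lt_compat in HS.
  pose proof (Hw j Hj).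
  apply Rmult_le_pos; [|lra]. apply Rmult_le_pos; [lra|]. apply Rmult_le_pos; lra.
Qed.

Lemma demand_pos p j : (j < n)%nat -> 0 < w j -> 0 < demand p j.
Proof.
  intros Hj Hwj. unfold demand, Rdiv. pose proof (priceIndex_pos p) as HS.
  pose proof (Rpower_pos (p j) (- c)). apply Rinv_0_lt_compat in HS.
  apply Rmult_lt_0_compat; [|lra]. apply Rmult_lt_0_compat; [lra|]. now apply Rmult_lt_0_compat.
Qed.

Lemma demand_unwanted p j : w j = 0 -> demand p j = 0.
Proof. intros H. unfold demand. rewrite H. unfold Rdiv. ring. Qed.

Lemma spending_eq p j : (j < n)%nat -> wantedPos p ->
  p j * demand p j = e * (w j * Rpower (p j) (1 - c)) / priceIndex p.
Proof.
  intros Hj Hp. unfold demand. destruct (Rle_lt_or_eq_dec 0 (w j) (Hw j Hj)) as [H|H].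
  - rewrite <- (Rpower_opp_mult (p j)) by auto. unfold Rdiv. ring.
  - rewrite <- H. unfold Rdiv. ring.
Qed.

Lemma demand_budget p : wantedPos p -> rsum n (fun j => p j * demand p j) = e.
Proof.
  intros Hp.
  rewrite (rsum_ext n _ (fun j => (e / priceIndex p) * (w j * Rpower (p j) (1 - c)))).
  - rewrite rsum_scal. fold (priceIndex p). pose proof (priceIndex_pos p). field; lra.
  - intros j Hj. rewrite spending_eq by auto. unfold Rdiv; ring.
Qed.

Lemma priceIndex_ext p p' : (forall j, (j < n)%nat -> p j = p' j) -> priceIndex p = priceIndex p'.
Proof. intros H. apply rsum_ext. intros j Hj; now rewrite H. Qed.

Lemma demand_ext p p' j : (forall k, (k < n)%nat -> p k = p' k) -> (j < n)%nat ->
  demand p j = demand p' j.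
Proof. intros H Hj. unfold demand. now rewrite (priceIndex_ext p p' H), (H j Hj). Qed.

(** Closeness is multiplicative because demands are quotients of powers. Only wanted goods are
    constrained: an unwanted one may have price 0 at a limit point. *)
Definition within (r : R) (p p' : nat -> R) : Prop :=
  forall k, (k < n)%nat -> 0 < w k ->
    0 < p k /\ 0 < p' k /\ p' k <= r * p k /\ p k <= r * p' k.

Lemma within_sym r p p' : within r p p' -> within r p' p.
Proof. intros H k Hk Hwk. destruct (H k Hk Hwk) as (A & B & C & D). auto. Qed.

Lemma priceIndex_ratio r p p' : 1 <= r -> within r p p' -> priceIndex p' <= r * priceIndex p.
Proof.
  intros Hr H. unfold priceIndex. rewrite <- rsum_scal. apply rsum_le. intros k Hk.
  destruct (Rle_lt_or_eq_dec 0 (w k) (Hw k Hk)) as [Hwk|Hwk]; [|rewrite <- Hwk; lra].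
  destruct (H k Hk Hwk) as (A & B & C & D).
  pose proof (Rpower_ratio (p k) (p' k) r (1 - c) A B Hr C ltac:(lra)). nra.
Qed.

Lemma div_ratio a b x y r s : 0 <= a -> 0 < x -> 0 < y -> 1 <= s -> 0 <= r ->
  b <= r * a -> x <= s * y -> b / y <= r * s * (a / x).
Proof.
  intros Ha Hx Hy Hs Hr Hb Hxy.
  apply Rmult_le_reg_r with (x * y); [nra|].
  replace (b / y * (x * y)) with (b * x) by (field; lra).
  replace (r * s * (a / x) * (x * y)) with (r * a * (s * y)) by (field; lra).
  apply Rle_trans with (r * a * x).
  - apply Rmult_le_compat_r; lra.
  - apply Rmult_le_compat_l; [apply Rmult_le_pos; lra|lra].
Qed.

Lemma demand_ratio_same r p p' j : 1 <= r -> within r p p' -> (j < n)%nat -> p' j = p j ->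
  demand p' j <= r * demand p j.
Proof.
  intros Hr H Hj E. unfold demand. rewrite E.
  replace r with (1 * r) by lra.
  pose proof (Rpower_pos (p j) (-c)). pose proof (Hw j Hj).
  apply div_ratio; try lra; try apply priceIndex_pos.
  - apply Rmult_le_pos; [lra|]. apply Rmult_le_pos; lra.
  - apply priceIndex_ratio; auto. now apply within_sym.
Qed.

Lemma Rpower_opp_ratio p p' r : 0 < p -> 0 < p' -> 1 <= r -> p <= r * p' ->
  Rpower p' (- c) <= r * Rpower p (- c).
Proof.
  intros Hp Hp' Hr H. rewrite !Rpower_Ropp.
  pose proof (Rpower_ratio p' p r c Hp' Hp Hr H Hc) as E.
  pose proof (Rpower_pos p c). pose proof (Rpower_pos p' c).
  apply Rmult_le_reg_r with (Rpower p' c * Rpower p c); [nra|].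
  replace (/ Rpower p' c * (Rpower p' c * Rpower p c)) with (Rpower p c) by (field; lra).
  replace (r * / Rpower p c * (Rpower p' c * Rpower p c)) with (r * Rpower p' c) by (field; lra).
  exact E.
Qed.

(** One factor [r] comes from the power of the own price, the other from the price index; the
    exponents [c] and [1 - c] lie in [0,1], so each ratio stays within [r]. *)
Lemma demand_ratio r p p' j : 1 <= r -> within r p p' -> (j < n)%nat ->
  demand p' j <= r * r * demand p j.
Proof.
  intros Hr H Hj. pose proof (Hw j Hj) as H0.
  destruct (Rle_lt_or_eq_dec 0 (w j) H0) as [Hwj|Hwj];
    [|rewrite !demand_unwanted by auto; lra].
  unfold demand.
  pose proof (Rpower_pos (p j) (-c)).
  apply div_ratio; try lra; try apply priceIndex_pos.
  - apply Rmult_le_pos; [lra|]. apply Rmult_le_pos; lra.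
  - destruct (H j Hj Hwj) as (A & B & C & D).
    pose proof (Rpower_opp_ratio (p j) (p' j) r A B Hr D).
    replace (r * (e * (w j * Rpower (p j) (- c)))) with (e * w j * (r * Rpower (p j) (- c))) by ring.
    rewrite <- Rmult_assoc. apply Rmult_le_compat_l; [nra|lra].
  - apply priceIndex_ratio; auto. now apply within_sym.
Qed.

Lemma within_wantedPos r p p' : within r p p' -> wantedPos p.
Proof. intros H k Hk Hwk. now destruct (H k Hk Hwk). Qed.

(** Written as [w p^(1-c)] over the index, spending contains a single power of the own price, so two
    factors [r] suffice; bounding price and demand separately would cost three. *)
Lemma spending_ratio r p p' k : 1 <= r -> within r p p' -> (k < n)%nat ->
  p' k * demand p' k <= r * r * (p k * demand p k).
Proof.
  intros Hr H Hk.
  rewrite !spending_eq; eauto using within_wantedPos, within_sym.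
  pose proof (Rpower_pos (p k) (1-c)) as HR0. pose proof (Hw k Hk) as Hwk0.
  apply div_ratio; try lra; try apply priceIndex_pos.
  - apply Rmult_le_pos; [lra|]. apply Rmult_le_pos; lra.
  - destruct (Rle_lt_or_eq_dec 0 (w k) Hwk0) as [Hwk|Hwk]; [|rewrite <- Hwk; lra].
    destruct (H k Hk Hwk) as (A & B & C & D).
    pose proof (Rpower_ratio (p k) (p' k) r (1 - c) A B Hr C ltac:(lra)).
    replace (r * (e * (w k * Rpower (p k) (1 - c)))) with (e * w k * (r * Rpower (p k) (1 - c))) by ring.
    rewrite <- Rmult_assoc. apply Rmult_le_compat_l; [nra|lra].
  - apply priceIndex_ratio; auto. now apply within_sym.
Qed.

(** * Effect of one price change on a buyer's demand *)

Definition changed (k : nat) (f : R) (p p' : nat -> R) : Prop :=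
  p' k = p k * (1 + f) /\ forall j, (j < n)%nat -> j <> k -> p' j = p j.

Lemma priceIndex_changed k f p p' :
  (k < n)%nat -> 0 < p k -> -1 < f -> changed k f p p' ->
  priceIndex p' = priceIndex p + w k * Rpower (p k) (1 - c) * (Rpower (1 + f) (1 - c) - 1).
Proof.
  intros Hk Hp Hf [E1 E2]. unfold priceIndex.
  rewrite (rsum_update n (fun k0 => w k0 * Rpower (p k0) (1 - c))
             (fun k0 => w k0 * Rpower (p' k0) (1 - c)) k Hk).
  - rewrite E1, <- Rpower_mult_distr by lra. ring.
  - intros j Hj Hjk. now rewrite E2.
Qed.

(** A foreign price acts on the demand for [j] only through the index, whose relative change is at
    most [Rabs f] times the budget share spent on [k]. The factor 21/20 covers [1 / (1 - 1/23)], as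
    the new index stands in the denominator. *)
Lemma demand_changed_cross k f p p' j :
  (k < n)%nat -> (j < n)%nat -> j <> k -> wantedPos p -> 0 < p k -> Rabs f <= 1/23 ->
  changed k f p p' ->
  Rabs (demand p' j - demand p j) <= 21/20 * Rabs f * (demand p j * (p k * demand p k / e)).
Proof.
  intros Hk Hj Hjk Hp Hpk Hf Hch.
  assert (Hf1 : -1 < f) by (apply Rabs_def2 with (a := 1) (x := f); lra).
  pose proof (priceIndex_changed k f p p' Hk Hpk Hf1 Hch) as ES.
  pose proof (Rpower_dist1 f (1 - c) Hf1 ltac:(lra)) as HR.
  pose proof (priceIndex_pos p) as HS. pose proof (priceIndex_pos p') as HS'.
  pose proof (Rpower_pos (p k) (1-c)) as HPk. pose proof (Hw k Hk) as Hwk.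
  assert (Ht : w k * Rpower (p k) (1 - c) <= priceIndex p).
  { apply (rsum_term_le n (fun k => w k * Rpower (p k) (1 - c))); auto.
    intros i Hi. apply Rmult_le_pos; [auto|left; apply Rpower_pos]. }
  rewrite spending_eq by auto.
  set (t := w k * Rpower (p k) (1 - c)) in *.
  assert (Ht0 : 0 <= t) by (unfold t; apply Rmult_le_pos; lra).
  set (d := Rpower (1 + f) (1 - c) - 1) in *.
  assert (Habs : Rabs (t * d) <= t * Rabs f).
  { rewrite Rabs_mult, (Rabs_pos_eq t) by lra. apply Rmult_le_compat_l; lra. }
  assert (HS2 : priceIndex p <= 21/20 * priceIndex p').
  { assert (- (t * d) <= t * Rabs f) by (pose proof (Rle_abs (-(t*d))) as Q; rewrite Rabs_Ropp in Q; lra).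
    assert (t * Rabs f <= priceIndex p * (1/23)) by (pose proof (Rabs_pos f); apply Rmult_le_compat; lra). lra. }
  assert (Hj' : demand p' j = demand p j * (priceIndex p / priceIndex p')).
  { unfold demand. destruct Hch as [_ E2]. rewrite E2 by auto. field; lra. }
  rewrite Hj'.
  replace (demand p j * (priceIndex p / priceIndex p') - demand p j)
    with (demand p j * (- (t * d) / priceIndex p')) by (rewrite ES; field; lra).
  pose proof (demand_nonneg p j Hj) as Hx.
  rewrite Rabs_mult, Rabs_pos_eq by auto.
  replace (21 / 20 * Rabs f * (demand p j * (e * t / priceIndex p / e)))
    with (demand p j * (21 / 20 * (Rabs f * t / priceIndex p))) by (field; lra).
  apply Rmult_le_compat_l; auto.
  unfold Rdiv. rewrite Rabs_mult, Rabs_Ropp, (Rabs_pos_eq (/ priceIndex p'))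
    by (left; now apply Rinv_0_lt_compat).
  change (Rabs (t * d) / priceIndex p' <= 21 * / 20 * (Rabs f * t / priceIndex p)).
  replace (21 * / 20 * (Rabs f * t / priceIndex p)) with (1 * (21/20) * (Rabs f * t / priceIndex p)) by lra.
  apply div_ratio; try lra. pose proof (Rabs_pos f). nra.
Qed.

Lemma changed_within k f p p' :
  (k < n)%nat -> wantedPos p -> Rabs f <= 1/23 -> changed k f p p' -> within (/ (1 - Rabs f)) p p'.
Proof.
  intros Hk Hp Hf [E1 E2] j Hj Hwj. pose proof (Hp j Hj Hwj) as Hpj.
  pose proof (Rabs_pos f) as H0.
  assert (Hr : 1 <= / (1 - Rabs f)) by (rewrite <- Rinv_1 at 1; apply Rinv_le_contravar; lra).
  assert (Hr' : / (1 - Rabs f) * (1 - Rabs f) = 1) by (apply Rinv_l; lra).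
  set (r := / (1 - Rabs f)) in *.
  assert (f <= Rabs f) by apply Rle_abs.
  assert (- f <= Rabs f) by (rewrite <- Rabs_Ropp; apply Rle_abs).
  destruct (Nat.eq_dec j k) as [->|Hjk].
  - rewrite E1. repeat split; auto.
    + apply Rmult_lt_0_compat; lra.
    + rewrite (Rmult_comm r). apply Rmult_le_compat_l; [lra|]. nra.
    + replace (r * (p k * (1 + f))) with (p k * (r * (1 + f))) by ring.
      rewrite <- (Rmult_1_r (p k)) at 1. apply Rmult_le_compat_l; [lra|].
      rewrite <- Hr'. apply Rmult_le_compat_l; lra.
  - rewrite E2 by auto. repeat split; auto; nra.
Qed.

(** Both directions of [demand_ratio] with [r = 1 / (1 - Rabs f)]; for [Rabs f <= 1/23] one has
    [r^2 <= 1 + 11/5 * Rabs f]. *)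
Lemma demand_changed_own k f p p' :
  (k < n)%nat -> wantedPos p -> Rabs f <= 1/23 -> changed k f p p' ->
  Rabs (demand p' k - demand p k) <= 11/5 * Rabs f * demand p k.
Proof.
  intros Hk Hp Hf Hch. pose proof (changed_within k f p p' Hk Hp Hf Hch) as Hr.
  pose proof (Rabs_pos f) as H0.
  assert (Hr1 : 1 <= / (1 - Rabs f)) by (rewrite <- Rinv_1 at 1; apply Rinv_le_contravar; lra).
  pose proof (demand_ratio _ p p' k Hr1 Hr Hk) as D1.
  pose proof (demand_ratio _ p' p k Hr1 (within_sym _ _ _ Hr) Hk) as D2.
  pose proof (demand_nonneg p k Hk). pose proof (demand_nonneg p' k Hk).
  set (a := Rabs f) in *. set (r := / (1 - a)) in *.
  assert (Er : r * (1 - a) = 1) by (apply Rinv_l; lra).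
  assert (Hr3 : r <= 23/22) by (apply Rmult_le_reg_r with (1 - a); lra).
  assert (Hrr : r * r <= 1 + 11/5 * a).
  { assert (r = 1 + r * a) by lra. nra. }
  apply Rabs_le. split; [|nra].
  assert (r * r * (1 - a) * (1 - a) = 1).
  { replace (r * r * (1 - a) * (1 - a)) with ((r * (1 - a)) * (r * (1 - a))) by ring.
    rewrite Er; ring. }
  assert (demand p k * ((1-a)*(1-a)) <= demand p' k).
  { replace (demand p' k) with (r * r * demand p' k * ((1-a)*(1-a))).
    - apply Rmult_le_compat_r; nra.
    - replace (r * r * demand p' k * ((1-a)*(1-a))) with (demand p' k * (r * r * (1-a)*(1-a))) by ring.
      rewrite H2. ring. }
  nra.
Qed.

(* The partial derivative in the price of [j] is minus the demand for [j]. *)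
Definition potential (p : nat -> R) : R :=
  if Rlt_dec c 1 then - (e / (1 - c)) * ln (priceIndex p)
  else - rsum n (fun j => e * w j / rsum n w * ln (p j)).

Lemma priceIndex_c1 p : c = 1 -> priceIndex p = rsum n w.
Proof.
  intros Hc1. apply rsum_ext. intros j Hj; cbv beta. replace (1 - c) with 0 by lra.
  unfold Rpower. rewrite Rmult_0_l, exp_0. ring.
Qed.

(** The deficit of [t^(1-c)] below its tangent at 1, divided by [1 - c]; the second branch is the
    limit for [c] tending to 1. For [c = 0] it vanishes for all positive [t], so there is no
    strictness for Leontief buyers. *)
Definition tangentGap (t : R) : R :=
  if Rlt_dec c 1 then (1 + (1 - c) * (t - 1) - Rpower t (1 - c)) / (1 - c) else t - 1 - ln t.

Lemma tangentGap_nonneg t : 0 < t -> 0 <= tangentGap t.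
Proof.
  intros Ht. unfold tangentGap. destruct (Rlt_dec c 1).
  - pose proof (Rpower_bernoulli t (1 - c) Ht ltac:(lra)).
    apply Rmult_le_pos; [lra|]. left. apply Rinv_0_lt_compat; lra.
  - pose proof (ln_le_minus_1 t Ht). lra.
Qed.

Lemma tangentGap_eq0 t : 0 < c -> 0 < t -> tangentGap t = 0 -> t = 1.
Proof.
  intros Hc0 Ht. unfold tangentGap. intros E. apply NNPP. intros Hne.
  destruct (Rlt_dec c 1).
  - pose proof (Rpower_bernoulli_strict t (1 - c) Ht Hne ltac:(lra)).
    assert (0 < (1 + (1 - c) * (t - 1) - Rpower t (1 - c)) / (1 - c))
      by (apply Rdiv_lt_0_compat; lra). lra.
  - pose proof (ln_lt_minus_1 t Ht Hne). lra.
Qed.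

(* Convexity of the potential; the left-hand side measures how strict the gradient inequality is. *)
Lemma potential_tangent p p' : wantedPos p -> wantedPos p' ->
  rsum n (fun j => p' j * demand p' j * tangentGap (p j / p' j)) <=
  potential p - potential p' + (rsum n (fun j => p j * demand p' j) - e).
Proof.
  intros Hp Hp'.
  pose proof (priceIndex_pos p) as HS. pose proof (priceIndex_pos p') as HS'.
  assert (Hsplit : rsum n (fun j => p j * demand p' j) - e =
                   rsum n (fun j => p j * demand p' j - p' j * demand p' j))
    by (rewrite rsum_minus, demand_budget; auto).
  rewrite Hsplit.
  unfold potential, tangentGap. destruct (Rlt_dec c 1) as [Hlt|Hge].
  - assert (Hln : ln (priceIndex p / priceIndex p') <= priceIndex p / priceIndex p' - 1)
      by (apply ln_le_minus_1, Rdiv_lt_0_compat; lra).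
    unfold Rdiv in Hln at 1. rewrite ln_mult, ln_Rinv in Hln by (auto using Rinv_0_lt_compat).
    (* Linearising the logarithm of the index ratio is the only estimate; what remains is an
       identity for each good. *)
    apply Rle_trans with (- (e / (1 - c)) * (priceIndex p / priceIndex p' - 1) +
      rsum n (fun j => p j * demand p' j - p' j * demand p' j)).
    2:{ assert (0 < e / (1 - c)) by (apply Rdiv_lt_0_compat; lra). nra. }
    replace (- (e / (1 - c)) * (priceIndex p / priceIndex p' - 1)) with
      (- (e / (1 - c) / priceIndex p') * (priceIndex p - priceIndex p')) by (field; lra).
    unfold priceIndex at 2 3. rewrite <- rsum_minus, <- rsum_scal, <- rsum_plus.
    apply rsum_le. intros j Hj.
    destruct (Rle_lt_or_eq_dec 0 (w j) (Hw j Hj)) as [Hwj|Hwj].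
    2:{ rewrite demand_unwanted, <- Hwj by auto. lra. }
    pose proof (Hp j Hj Hwj) as P1. pose proof (Hp' j Hj Hwj) as P2.
    unfold demand. rewrite <- (Rpower_opp_mult (p' j)) by auto.
    replace (Rpower (p j) (1 - c)) with (p' j * Rpower (p' j) (- c) * Rpower (p j / p' j) (1 - c)).
    2:{ rewrite Rpower_opp_mult by auto. rewrite Rpower_mult_distr; auto.
        - f_equal. field; lra.
        - now apply Rdiv_lt_0_compat. }
    right. field. lra.
  - assert (Hc1 : c = 1) by lra.
    replace (- rsum n (fun j => e * w j / rsum n w * ln (p j)) -
             - rsum n (fun j => e * w j / rsum n w * ln (p' j)))
      with (rsum n (fun j => e * w j / rsum n w * ln (p' j)) -
            rsum n (fun j => e * w j / rsum n w * ln (p j))) by ring.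
    rewrite <- rsum_minus, <- rsum_plus. apply rsum_le. intros j Hj.
    destruct (Rle_lt_or_eq_dec 0 (w j) (Hw j Hj)) as [Hwj|Hwj].
    2:{ rewrite demand_unwanted, <- Hwj by auto. lra. }
    pose proof (Hp j Hj Hwj) as P1. pose proof (Hp' j Hj Hwj) as P2.
    assert (HW : 0 < rsum n w) by (rewrite <- (priceIndex_c1 p Hc1); auto).
    assert (Hd : demand p' j = e * w j / rsum n w * / p' j).
    { unfold demand. rewrite (priceIndex_c1 p' Hc1), Hc1, Rpower_Ropp, Rpower_1 by auto.
      unfold Rdiv; ring. }
    rewrite Hd. change (p j / p' j) with (p j * / p' j). rewrite ln_mult, ln_Rinv by (auto using Rinv_0_lt_compat).
    right. field. lra.
Qed.

Lemma tangent_term_nonneg p p' j : (j < n)%nat -> wantedPos p -> wantedPos p' ->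
  0 <= p' j * demand p' j * tangentGap (p j / p' j).
Proof.
  intros Hj Hp Hp'. destruct (Rle_lt_or_eq_dec 0 (w j) (Hw j Hj)) as [Hwj|Hwj].
  2:{ rewrite demand_unwanted by auto. lra. }
  apply Rmult_le_pos.
  - apply Rmult_le_pos; [left; auto|now apply demand_nonneg].
  - apply tangentGap_nonneg, Rdiv_lt_0_compat; auto.
Qed.

Lemma potential_tangent_nonneg p p' : wantedPos p -> wantedPos p' ->
  0 <= potential p - potential p' + (rsum n (fun j => p j * demand p' j) - e).
Proof.
  intros Hp Hp'. eapply Rle_trans; [|now apply potential_tangent].
  apply rsum_nonneg. intros j Hj. now apply tangent_term_nonneg.
Qed.

(** Equality makes every term of the gap sum vanish, and spending on a wanted good is positive, so
    its [tangentGap] is 0. *)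
Lemma potential_tangent_eq0 p p' : 0 < c -> wantedPos p -> wantedPos p' ->
  potential p - potential p' + (rsum n (fun j => p j * demand p' j) - e) <= 0 ->
  forall j, (j < n)%nat -> 0 < w j -> p j = p' j.
Proof.
  intros Hc0 Hp Hp' H0 j Hj Hwj.
  assert (E : p' j * demand p' j * tangentGap (p j / p' j) = 0).
  { apply (rsum_nonneg_eq0 n (fun j => p' j * demand p' j * tangentGap (p j / p' j))); auto.
    - intros k Hk. now apply tangent_term_nonneg.
    - eapply Rle_trans; [now apply potential_tangent|auto]. }
  pose proof (Hp j Hj Hwj) as P1. pose proof (Hp' j Hj Hwj) as P2.
  pose proof (demand_pos p' j Hj Hwj) as P3.
  apply Rmult_integral in E as [E|E]; [nra|].
  apply tangentGap_eq0 in E; auto; [|now apply Rdiv_lt_0_compat].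
  rewrite <- (Rmult_1_l (p' j)), <- E. field; lra.
Qed.

(** The gradient inequality at the new prices [p']: no remainder appears, and the budget [e] cancels
    against the spending at [p'], which leaves only the term of good [k]. *)
Lemma potential_step k f p p' :
  (k < n)%nat -> wantedPos p -> wantedPos p' -> changed k f p p' ->
  potential p' - potential p <= - demand p' k * (p' k - p k).
Proof.
  intros Hk Hp Hp' [_ E2]. pose proof (potential_tangent_nonneg p p' Hp Hp') as H.
  pose proof (demand_budget p' Hp') as Hb.
  rewrite (rsum_update n (fun j => p' j * demand p' j) (fun j => p j * demand p' j) k Hk) in H.
  - lra.
  - intros j Hj E. now rewrite E2.
Qed.

Lemma potential_lower B : 0 < B ->
  exists C, forall p, (forall j, (j < n)%nat -> 0 < p j <= B) -> C <= potential p.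
Proof.
  intros HB. unfold potential. destruct (Rlt_dec c 1) as [Hlt|Hge].
  - exists (- (e / (1 - c)) * ln (priceIndex (fun _ => B))). intros p Hp.
    assert (priceIndex p <= priceIndex (fun _ => B)).
    { apply rsum_le. intros j Hj. apply Rmult_le_compat_l; [auto|].
      apply Rle_Rpower_l; [lra|auto]. }
    pose proof (ln_le _ _ (priceIndex_pos p) H).
    assert (0 < e / (1 - c)) by (apply Rdiv_lt_0_compat; lra). nra.
  - exists (- rsum n (fun j => e * w j / rsum n w * ln B)). intros p Hp.
    apply Ropp_le_contravar, rsum_le. intros j Hj. destruct (Hp j Hj).
    apply Rmult_le_compat_l; [|apply ln_le; lra].
    assert (HW : 0 < rsum n w) by (destruct Hwpos as [k [Hk Hwk]]; now apply rsum_pos with k).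
    apply Rmult_le_pos; [apply Rmult_le_pos; [lra|auto]|left; now apply Rinv_0_lt_compat].
Qed.

(** Serves to keep the bundle cost of a Leontief buyer away from 0 even though single prices may
    vanish. *)
Lemma priceIndex_lower C : c < 1 ->
  exists s, 0 < s /\ forall p, potential p <= C -> s <= priceIndex p.
Proof.
  intros Hc1. exists (exp (- C * (1 - c) / e)). split; [apply exp_pos|].
  intros p Hp. unfold potential in Hp. destruct (Rlt_dec c 1); [|lra].
  pose proof (priceIndex_pos p) as HS. rewrite <- (exp_ln (priceIndex p) HS).
  assert (H : - C * (1 - c) / e <= ln (priceIndex p)).
  { apply Rmult_le_reg_l with (e / (1 - c)); [apply Rdiv_lt_0_compat; lra|].
    replace (e / (1 - c) * (- C * (1 - c) / e)) with (- C) by (field; lra). lra. }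
  destruct H as [H|H]; [left; now apply exp_increasing|rewrite H; lra].
Qed.

End Buyer.

(** * CES and Leontief demands *)

Lemma starved_true n a x :
  starved n a x = true <-> exists j, (j < n)%nat /\ 0 < a j /\ x j <= 0.
Proof.
  induction n as [|n IH]; simpl.
  - split; [discriminate|]. intros [j [H _]]; lia.
  - rewrite Bool.orb_true_iff, IH. split.
    + intros [[j [H1 H2]]|H]; [exists j; auto with arith|].
      destruct (Rlt_dec 0 (a n)); [|discriminate].
      destruct (Rle_dec (x n) 0); [|discriminate]. exists n; auto.
    + intros [j [H1 [H2 H3]]]. destruct (Nat.eq_dec j n) as [->|Hn].
      * right. destruct (Rlt_dec 0 (a n)); [|lra]. destruct (Rle_dec (x n) 0); [auto|lra].
      * left. exists j. split; [lia|auto].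
Qed.

Lemma starved_false n a x :
  starved n a x = false <-> forall j, (j < n)%nat -> 0 < a j -> 0 < x j.
Proof.
  split.
  - intros H j Hj Ha. apply Rnot_le_lt. intros Hx.
    assert (starved n a x = true) by (apply starved_true; eauto). congruence.
  - intros H. destruct (starved n a x) eqn:E; [|reflexivity].
    apply starved_true in E as [j [Hj [Ha Hx]]]. specialize (H j Hj Ha). lra.
Qed.

Lemma rprod_ext n f g : (forall j, (j < n)%nat -> f j = g j) -> rprod n f = rprod n g.
Proof.
  induction n as [|n IH]; intros H; simpl; [reflexivity|].
  rewrite IH, H; auto with arith.
Qed.

Lemma rprod_pos n f : (forall j, (j < n)%nat -> 0 < f j) -> 0 < rprod n f.
Proof.
  induction n as [|n IH]; intros H; simpl; [lra|].
  apply Rmult_lt_0_compat; auto with arith.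
Qed.

Lemma ln_rprod n f : (forall j, (j < n)%nat -> 0 < f j) ->
  ln (rprod n f) = rsum n (fun j => ln (f j)).
Proof.
  induction n as [|n IH]; intros H; simpl; [apply ln_1|].
  rewrite ln_mult, IH; auto using rprod_pos with arith.
Qed.

Lemma ces_util_ext n a rho x y :
  (forall j, (j < n)%nat -> 0 < a j -> x j = y j) -> ces_util n a rho x = ces_util n a rho y.
Proof.
  intros H. unfold ces_util.
  assert (Es : starved n a x = starved n a y).
  { destruct (starved n a x) eqn:E; symmetry.
    - apply starved_true in E as [j [Hj [Ha Hx]]]. apply starved_true.
      exists j. rewrite <- H; auto.
    - rewrite starved_false in *. intros j Hj Ha. rewrite <- H; auto. }
  rewrite Es. destruct (starved n a y); [reflexivity|].
  destruct (Rlt_dec rho 0).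
  - f_equal. apply rsum_ext. intros j Hj. destruct (Rlt_dec 0 (a j)); [now rewrite H|reflexivity].
  - apply rprod_ext. intros j Hj. destruct (Rlt_dec 0 (a j)); [now rewrite H|reflexivity].
Qed.

(** * Optimality and uniqueness of the CES demand *)

Section CES.
Variables (n : nat) (a : nat -> R) (rho e : R).
Hypothesis Hrho : rho <= 0.
Hypothesis Hapos : exists j, (j < n)%nat /\ 0 < a j.
Hypothesis He : 0 < e.

Definition ces_exponent : R := / (1 - rho).
Definition ces_weight (j : nat) : R :=
  if Rlt_dec 0 (a j) then Rpower (a j) ces_exponent else 0.

Lemma ces_exponent_range : 0 < ces_exponent <= 1.
Proof.
  unfold ces_exponent. split; [apply Rinv_0_lt_compat; lra|].
  rewrite <- Rinv_1. apply Rinv_le_contravar; lra.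
Qed.

Lemma ces_weight_nonneg j : 0 <= ces_weight j.
Proof. unfold ces_weight. destruct (Rlt_dec 0 (a j)); [left; apply Rpower_pos|lra]. Qed.

Lemma ces_weight_pos j : 0 < ces_weight j <-> 0 < a j.
Proof.
  unfold ces_weight. destruct (Rlt_dec 0 (a j)); [|lra]. split; auto using Rpower_pos.
Qed.

Lemma ces_weight_exists : exists j, (j < n)%nat /\ 0 < ces_weight j.
Proof. destruct Hapos as [j [Hj H]]. exists j. now rewrite ces_weight_pos. Qed.

Notation x_of := (demand n ces_weight ces_exponent e).

(** Logarithmic coordinates treat both cases alike. For [rho < 0] each term is bounded by the
    tangent of [exp] at 0, the negative [1 / rho] reversing the order; for [rho = 0] the logarithm
    of the utility is linear in these coordinates. *)
Lemma ces_util_le_log x y :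
  (forall j, (j < n)%nat -> 0 < a j -> 0 < x j) ->
  (forall j, (j < n)%nat -> 0 < a j -> 0 < y j) ->
  ces_util n a rho x <= ces_util n a rho y ->
  0 <= rsum n (fun j => if Rlt_dec 0 (a j)
                        then a j * Rpower (x j) rho * (ln (y j) - ln (x j)) else 0).
Proof.
  intros Hx Hy. unfold ces_util.
  rewrite (proj2 (starved_false n a x) Hx), (proj2 (starved_false n a y) Hy).
  set (F := fun z : nat -> R => rsum n (fun j => if Rlt_dec 0 (a j) then a j * Rpower (z j) rho else 0)).
  destruct (Rlt_dec rho 0) as [Hr|Hr]; intros Hle.
  - fold (F x) in Hle. fold (F y) in Hle.
    assert (HF : forall z, 0 < F z).
    { intros z. destruct Hapos as [k [Hk Hak]].
      apply rsum_pos with k; auto.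
      - intros j Hj. destruct (Rlt_dec 0 (a j)); [|lra].
        apply Rlt_le, Rmult_lt_0_compat; auto using Rpower_pos.
      - destruct (Rlt_dec 0 (a k)); [|lra]. apply Rmult_lt_0_compat; auto using Rpower_pos. }
    assert (HFle : F y <= F x).
    { apply Rnot_lt_le. intros Hlt. apply (ln_increasing _ _ (HF x)) in Hlt.
      apply Rle_not_lt in Hle. apply Hle. unfold Rpower. apply exp_increasing.
      assert (1 / rho < 0) by (unfold Rdiv; rewrite Rmult_1_l; now apply Rinv_lt_0_compat). nra. }
    assert (Hsum : rho * rsum n (fun j => if Rlt_dec 0 (a j)
                        then a j * Rpower (x j) rho * (ln (y j) - ln (x j)) else 0) <= F y - F x).
    { unfold F. rewrite <- rsum_scal, <- rsum_minus. apply rsum_le. intros j Hj.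
      destruct (Rlt_dec 0 (a j)) as [Haj|]; [|lra].
      assert (E : Rpower (y j) rho = Rpower (x j) rho * exp (rho * (ln (y j) - ln (x j)))).
      { unfold Rpower. rewrite <- exp_plus. f_equal; ring. }
      rewrite E. pose proof (exp_ineq1_le (rho * (ln (y j) - ln (x j)))) as Hexp.
      pose proof (Rpower_pos (x j) rho) as HP.
      assert (0 < a j * Rpower (x j) rho) by (now apply Rmult_lt_0_compat). nra. }
    nra.
  - assert (Hr0 : rho = 0) by lra.
    set (G := fun z : nat -> R => rprod n (fun j => if Rlt_dec 0 (a j) then Rpower (z j) (a j) else 1)).
    fold (G x) in Hle. fold (G y) in Hle.
    assert (HG : forall z, ln (G z) = rsum n (fun j => if Rlt_dec 0 (a j) then a j * ln (z j) else 0)).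
    { intros z. unfold G. rewrite ln_rprod.
      - apply rsum_ext. intros j Hj. destruct (Rlt_dec 0 (a j)); [|apply ln_1].
        unfold Rpower. apply ln_exp.
      - intros j Hj. destruct (Rlt_dec 0 (a j)); [apply Rpower_pos|lra]. }
    assert (Hpos : 0 < G x).
    { apply rprod_pos. intros j Hj. destruct (Rlt_dec 0 (a j)); [apply Rpower_pos|lra]. }
    apply (ln_le _ _ Hpos) in Hle. rewrite !HG in Hle.
    rewrite (rsum_ext n _ (fun j => (if Rlt_dec 0 (a j) then a j * ln (y j) else 0) -
                                    (if Rlt_dec 0 (a j) then a j * ln (x j) else 0))).
    + rewrite rsum_minus. lra.
    + intros j Hj. destruct (Rlt_dec 0 (a j)) as [Haj|]; [|ring].
      rewrite Hr0, Rpower_O by auto. ring.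
Qed.

(** The first-order condition times the quantity, with one multiplier for all wanted goods. It rests
    on [ces_exponent * (rho - 1) = -1]. *)
Lemma ces_demand_foc q j : (j < n)%nat -> 0 < a j -> 0 < q j ->
  a j * Rpower (x_of q j) rho
  = Rpower (e / priceIndex n ces_weight ces_exponent q) (rho - 1) * (q j * x_of q j).
Proof.
  intros Hj Haj Hq.
  assert (HS : 0 < priceIndex n ces_weight ces_exponent q).
  { apply priceIndex_pos; auto using ces_weight_exists. intros; apply ces_weight_nonneg. }
  assert (Hx : 0 < x_of q j).
  { apply demand_pos; auto using ces_weight_exists; [intros; apply ces_weight_nonneg|].
    now apply ces_weight_pos. }
  set (E := e / priceIndex n ces_weight ces_exponent q) in *.
  assert (HE : 0 < E) by (apply Rdiv_lt_0_compat; auto).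
  assert (Ex : ln (x_of q j) = ln E + ces_exponent * ln (a j) - ces_exponent * ln (q j)).
  { unfold demand. replace (e * (ces_weight j * Rpower (q j) (- ces_exponent)) /
      priceIndex n ces_weight ces_exponent q)
      with (E * (ces_weight j * Rpower (q j) (- ces_exponent))) by (unfold E, Rdiv; ring).
    unfold ces_weight. destruct (Rlt_dec 0 (a j)); [|lra].
    rewrite !ln_mult by (auto using Rmult_lt_0_compat, Rpower_pos).
    unfold Rpower. rewrite !ln_exp. ring. }
  replace (Rpower (x_of q j) rho) with (x_of q j * Rpower (x_of q j) (rho - 1)).
  2:{ rewrite <- (Rpower_1 (x_of q j)) at 1 by auto. rewrite <- Rpower_plus. f_equal; ring. }
  assert (E2 : Rpower (x_of q j) (rho - 1) = Rpower E (rho - 1) * (q j * / a j)).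
  { unfold Rpower. rewrite Ex, <- (exp_ln (q j * / a j)) by
      (apply Rmult_lt_0_compat; auto; now apply Rinv_0_lt_compat).
    rewrite <- exp_plus. f_equal. rewrite ln_mult, ln_Rinv by (auto using Rinv_0_lt_compat).
    unfold ces_exponent. field. lra. }
  rewrite E2. field. lra.
Qed.

(** With [x] the formula demand, the first-order condition turns [ces_util_le_log] into
    [sum q x ln(y/x) >= 0], while [ln r <= r - 1] bounds this sum by the difference of costs, which
    is at most 0. Equality in every term gives [y = x]. Optimality and uniqueness both follow. *)
Lemma ces_demand_unique_wanted q y :
  (forall j, (j < n)%nat -> 0 <= q j) -> wantedPos n ces_weight q ->
  (forall j, (j < n)%nat -> 0 <= y j) -> rsum n (fun j => q j * y j) <= e ->
  ces_util n a rho (x_of q) <= ces_util n a rho y ->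
  forall j, (j < n)%nat -> 0 < a j -> y j = x_of q j.
Proof.
  intros Hq Hwp Hy Hcost Hu.
  assert (Hqw : forall j, (j < n)%nat -> 0 < a j -> 0 < q j).
  { intros j Hj Haj. apply Hwp; auto. now apply ces_weight_pos. }
  assert (HwN : forall j, (j < n)%nat -> 0 <= ces_weight j) by (intros; apply ces_weight_nonneg).
  assert (Hx : forall j, (j < n)%nat -> 0 < a j -> 0 < x_of q j).
  { intros j Hj Haj. apply demand_pos; auto using ces_weight_exists. now apply ces_weight_pos. }
  assert (Hux : 0 < ces_util n a rho (x_of q)).
  { unfold ces_util. rewrite (proj2 (starved_false n a _) Hx).
    destruct (Rlt_dec rho 0); [apply Rpower_pos|]. apply rprod_pos. intros j Hj.
    destruct (Rlt_dec 0 (a j)); [apply Rpower_pos|lra]. }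
  assert (Hyp : forall j, (j < n)%nat -> 0 < a j -> 0 < y j).
  { apply starved_false. destruct (starved n a y) eqn:E; [|reflexivity].
    unfold ces_util at 2 in Hu. rewrite E in Hu. lra. }
  pose proof (ces_util_le_log _ _ Hx Hyp Hu) as Hlog.
  set (mu := Rpower (e / priceIndex n ces_weight ces_exponent q) (rho - 1)).
  assert (Hmu : 0 < mu) by apply Rpower_pos.
  rewrite (rsum_ext n _ (fun j => mu * (if Rlt_dec 0 (a j) then
     q j * x_of q j * (ln (y j) - ln (x_of q j)) else 0))) in Hlog.
  2:{ intros j Hj. destruct (Rlt_dec 0 (a j)) as [Haj|]; [|ring].
      rewrite ces_demand_foc by auto. fold mu. ring. }
  rewrite rsum_scal in Hlog.
  set (L := rsum n _) in Hlog.
  assert (HL : 0 <= L) by nra. unfold L in HL. clear L Hlog.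
  pose proof ces_exponent_range as Hcr.
  assert (Hb : rsum n (fun j => q j * x_of q j) = e)
    by (apply demand_budget; auto using ces_weight_exists).
  assert (Hterm : forall j, (j < n)%nat -> 0 < a j -> y j <> x_of q j ->
     0 < q j * (y j - x_of q j) - q j * x_of q j * (ln (y j) - ln (x_of q j))).
  { intros j Hj Haj Hne. pose proof (Hx j Hj Haj) as H1. pose proof (Hyp j Hj Haj) as H2.
    pose proof (Hqw j Hj Haj) as H3.
    assert (Hl : ln (y j * / x_of q j) < y j * / x_of q j - 1).
    { apply ln_lt_minus_1; [apply Rmult_lt_0_compat; auto using Rinv_0_lt_compat|].
      intros E. apply Hne. apply Rmult_eq_reg_r with (/ x_of q j);
        [|apply Rinv_neq_0_compat; lra]. rewrite E. field; lra. }
    rewrite ln_mult, ln_Rinv in Hl by (auto using Rinv_0_lt_compat).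
    assert (H4 : 0 < q j * x_of q j) by (now apply Rmult_lt_0_compat).
    replace (q j * (y j - x_of q j)) with (q j * x_of q j * (y j * / x_of q j - 1)) by (field; lra).
    nra. }
  assert (H0 : forall j, (j < n)%nat ->
     q j * (y j - x_of q j) - (if Rlt_dec 0 (a j) then
        q j * x_of q j * (ln (y j) - ln (x_of q j)) else 0) = 0).
  { apply rsum_nonneg_eq0.
    - intros j Hj. destruct (Rlt_dec 0 (a j)) as [Haj|Haj].
      + destruct (Req_dec (y j) (x_of q j)) as [E|E]; [rewrite E; lra|].
        left. now apply Hterm.
      + rewrite demand_unwanted.
        * pose proof (Hq j Hj). pose proof (Hy j Hj). nra.
        * unfold ces_weight. destruct (Rlt_dec 0 (a j)); [lra|reflexivity].
    - rewrite rsum_minus.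
      rewrite (rsum_ext n (fun j => q j * (y j - x_of q j)) (fun j => q j * y j - q j * x_of q j))
        by (intros; ring).
      rewrite rsum_minus, Hb. lra. }
  intros j Hj Haj. apply NNPP. intros Hne. specialize (Hterm j Hj Haj Hne).
  specialize (H0 j Hj). destruct (Rlt_dec 0 (a j)); lra.
Qed.

Lemma ces_demand_optimal q :
  (forall j, (j < n)%nat -> 0 <= q j) -> wantedPos n ces_weight q ->
  IsDemand n (ces_util n a rho) e q (x_of q).
Proof.
  intros Hq Hwp. pose proof ces_exponent_range as Hcr.
  assert (HwN : forall j, (j < n)%nat -> 0 <= ces_weight j) by (intros; apply ces_weight_nonneg).
  split; [|split].
  - intros j Hj. apply demand_nonneg; auto using ces_weight_exists.
  - rewrite demand_budget; auto using ces_weight_exists. lra.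
  - intros y Hy Hcost. apply Rnot_lt_le. intros Hlt.
    pose proof (ces_demand_unique_wanted q y Hq Hwp Hy Hcost ltac:(lra)) as E.
    rewrite (ces_util_ext n a rho y (x_of q) E) in Hlt. lra.
Qed.

(** The wanted goods already exhaust the budget, so at positive prices nothing is left for the
    others. *)
Lemma ces_demand_unique q x :
  (forall j, (j < n)%nat -> 0 < q j) -> IsDemand n (ces_util n a rho) e q x ->
  forall j, (j < n)%nat -> x j = x_of q j.
Proof.
  intros Hq (Hx & Hcost & Hopt).
  assert (Hq0 : forall j, (j < n)%nat -> 0 <= q j) by (intros j Hj; pose proof (Hq j Hj); lra).
  assert (Hwp : wantedPos n ces_weight q) by (intros j Hj _; auto).
  destruct (ces_demand_optimal q Hq0 Hwp) as (Hx' & Hc' & _).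
  pose proof (ces_demand_unique_wanted q x Hq0 Hwp Hx Hcost (Hopt _ Hx' Hc')) as E.
  pose proof ces_exponent_range as Hcr.
  assert (HwN : forall j, (j < n)%nat -> 0 <= ces_weight j) by (intros; apply ces_weight_nonneg).
  assert (Hb : rsum n (fun j => q j * x_of q j) = e)
    by (apply demand_budget; auto using ces_weight_exists).
  assert (H0 : forall j, (j < n)%nat -> q j * x j - q j * x_of q j = 0).
  { apply rsum_nonneg_eq0; [|rewrite rsum_minus; lra].
    intros j Hj. destruct (Rlt_dec 0 (a j)) as [Haj|Haj]; [rewrite E; auto; lra|].
    rewrite demand_unwanted.
    - pose proof (Hq0 j Hj). pose proof (Hx j Hj). nra.
    - unfold ces_weight. destruct (Rlt_dec 0 (a j)); [lra|reflexivity]. }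
  intros j Hj. specialize (H0 j Hj). pose proof (Hq j Hj). nra.
Qed.

End CES.

(** * Optimality and uniqueness of the Leontief demand *)

Lemma min_over_spec n A f :
  match min_over n A f with
  | None => forall j, (j < n)%nat -> A j = false
  | Some v => (forall j, (j < n)%nat -> A j = true -> v <= f j) /\
              exists j, (j < n)%nat /\ A j = true /\ v = f j
  end.
Proof.
  induction n as [|n IH]; simpl; [intros; lia|].
  destruct (A n) eqn:EA; destruct (min_over n A f) as [v|].
  - destruct IH as (Hv & j0 & Hj0 & HA0 & Ev). split.
    + intros j Hj Hjt. destruct (Nat.eq_dec j n) as [->|Hne]; [apply Rmin_r|].
      eapply Rle_trans; [apply Rmin_l|]. apply Hv; [lia|auto].
    + unfold Rmin. destruct (Rle_dec v (f n)); [exists j0|exists n]; auto with arith.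
  - split; [|exists n; auto].
    intros j Hj Hjt. destruct (Nat.eq_dec j n) as [->|Hne]; [lra|].
    rewrite IH in Hjt by lia. discriminate.
  - destruct IH as (Hv & j0 & Hj0 & HA0 & Ev). split; [|exists j0; auto with arith].
    intros j Hj Hjt. destruct (Nat.eq_dec j n) as [->|Hne]; [congruence|].
    apply Hv; [lia|auto].
  - intros j Hj. destruct (Nat.eq_dec j n) as [->|Hne]; [auto|]. apply IH; lia.
Qed.

Section Leontief.
Variables (n : nat) (A : nat -> bool) (b : nat -> R) (e : R).
Hypothesis HA : exists j, (j < n)%nat /\ A j = true.
Hypothesis Hb : forall j, (j < n)%nat -> A j = true -> 0 < b j.
Hypothesis He : 0 < e.

Definition leontief_weight (j : nat) : R := if A j then / b j else 0.
(* For [c = 0] this is [priceIndex], except at zero prices, where [Rpower 0 1 = 1] makes the latter wrong. *)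
Definition bundleCost (w q : nat -> R) : R := rsum n (fun k => w k * q k).
Definition leontief_demand (w q : nat -> R) (j : nat) : R := e * w j / bundleCost w q.

Lemma leontief_weight_nonneg j : (j < n)%nat -> 0 <= leontief_weight j.
Proof.
  intros Hj. unfold leontief_weight. destruct (A j) eqn:E; [|lra].
  left. apply Rinv_0_lt_compat. auto.
Qed.

Lemma leontief_weight_exists : exists j, (j < n)%nat /\ 0 < leontief_weight j.
Proof.
  destruct HA as [j [Hj E]]. exists j. split; auto. unfold leontief_weight. rewrite E.
  apply Rinv_0_lt_compat. auto.
Qed.

Lemma leontief_util_ge y j : (j < n)%nat ->
  (forall k, (k < n)%nat -> 0 <= y k) ->
  leontief_util n A b y * leontief_weight j <= y j.
Proof.
  intros Hj Hy. unfold leontief_util, leontief_weight.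
  pose proof (min_over_spec n A (fun j => b j * y j)) as H.
  destruct (A j) eqn:EA; [|rewrite Rmult_0_r; auto].
  destruct (min_over n A (fun j => b j * y j)) as [v|].
  - destruct H as [H _]. specialize (H j Hj EA). pose proof (Hb j Hj EA).
    apply Rmult_le_reg_r with (b j); auto. rewrite Rmult_assoc, Rinv_l by lra. lra.
  - rewrite H in EA by auto. discriminate.
Qed.

Lemma leontief_util_demand q :
  leontief_util n A b (leontief_demand leontief_weight q) = e / bundleCost leontief_weight q.
Proof.
  unfold leontief_util.
  pose proof (min_over_spec n A (fun j => b j * leontief_demand leontief_weight q j)) as H.
  destruct (min_over n A _) as [v|].
  - destruct H as [_ [j [Hj [EA ->]]]]. unfold leontief_demand, leontief_weight at 1. rewrite EA.
    pose proof (Hb j Hj EA). unfold Rdiv.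
    replace (b j * (e * / b j * / bundleCost leontief_weight q)) with
      ((b j * / b j) * (e * / bundleCost leontief_weight q)) by ring.
    rewrite Rinv_r by lra. ring.
  - destruct HA as [j [Hj EA]]. rewrite H in EA by auto. discriminate.
Qed.

Lemma leontief_demand_optimal q :
  (forall j, (j < n)%nat -> 0 <= q j) -> 0 < bundleCost leontief_weight q ->
  IsDemand n (leontief_util n A b) e q (leontief_demand leontief_weight q).
Proof.
  intros Hq Hl. split; [|split].
  - intros j Hj. unfold leontief_demand, Rdiv. pose proof (leontief_weight_nonneg j Hj).
    apply Rmult_le_pos; [apply Rmult_le_pos; lra|]. left; now apply Rinv_0_lt_compat.
  - rewrite (rsum_ext n _ (fun j => e / bundleCost leontief_weight q * (leontief_weight j * q j))).
    + rewrite rsum_scal. fold (bundleCost leontief_weight q). right. field. lra.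
    + intros j Hj. unfold leontief_demand, Rdiv. ring.
  - intros y Hy Hcost. rewrite leontief_util_demand.
    apply Rmult_le_reg_r with (bundleCost leontief_weight q); auto.
    replace (e / bundleCost leontief_weight q * bundleCost leontief_weight q) with e by (field; lra).
    eapply Rle_trans; [|exact Hcost]. unfold bundleCost. rewrite <- rsum_scal.
    apply rsum_le. intros j Hj. pose proof (leontief_util_ge y j Hj Hy). pose proof (Hq j Hj). nra.
Qed.

(** An optimal [x] has utility at least [e / bundleCost], hence dominates the formula good by good;
    it cannot cost more, so at positive prices the two coincide. *)
Lemma leontief_demand_unique q x :
  (forall j, (j < n)%nat -> 0 < q j) -> IsDemand n (leontief_util n A b) e q x ->
  forall j, (j < n)%nat -> x j = leontief_demand leontief_weight q j.
Proof.
  intros Hq (Hx & Hcost & Hopt).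
  assert (Hq0 : forall j, (j < n)%nat -> 0 <= q j) by (intros j Hj; pose proof (Hq j Hj); lra).
  assert (Hl : 0 < bundleCost leontief_weight q).
  { destruct leontief_weight_exists as [k [Hk Hwk]]. apply rsum_pos with k; auto.
    - intros j Hj. apply Rmult_le_pos; auto using leontief_weight_nonneg.
    - apply Rmult_lt_0_compat; auto. }
  destruct (leontief_demand_optimal q Hq0 Hl) as (Hx' & Hc' & _).
  pose proof (Hopt _ Hx' Hc') as Hu. rewrite leontief_util_demand in Hu.
  assert (Hge : forall j, (j < n)%nat -> leontief_demand leontief_weight q j <= x j).
  { intros j Hj. eapply Rle_trans; [|apply leontief_util_ge; auto].
    unfold leontief_demand. replace (e * leontief_weight j / bundleCost leontief_weight q) with
      (e / bundleCost leontief_weight q * leontief_weight j) by (unfold Rdiv; ring).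
    apply Rmult_le_compat_r; auto using leontief_weight_nonneg. }
  assert (Hbud : rsum n (fun j => q j * leontief_demand leontief_weight q j) = e).
  { rewrite (rsum_ext n _ (fun j => e / bundleCost leontief_weight q * (leontief_weight j * q j))).
    + rewrite rsum_scal. fold (bundleCost leontief_weight q). field. lra.
    + intros j Hj. unfold leontief_demand, Rdiv. ring. }
  assert (H0 : forall j, (j < n)%nat -> q j * x j - q j * leontief_demand leontief_weight q j = 0).
  { apply rsum_nonneg_eq0; [|rewrite rsum_minus; lra].
    intros j Hj. pose proof (Hge j Hj). pose proof (Hq0 j Hj). nra. }
  intros j Hj. specialize (H0 j Hj). pose proof (Hq j Hj). nra.
Qed.

Lemma leontief_demand_eq w q j : (j < n)%nat ->
  (forall k, (k < n)%nat -> 0 < q k) -> leontief_demand w q j = demand n w 0 e q j.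
Proof.
  intros Hj Hq. unfold leontief_demand, demand, bundleCost, priceIndex.
  rewrite Ropp_0, Rpower_O by auto.
  rewrite (rsum_ext n (fun k => w k * Rpower (q k) (1 - 0)) (fun k => w k * q k)).
  - now rewrite Rmult_1_r.
  - intros k Hk. rewrite Rminus_0_r, Rpower_1; auto.
Qed.

End Leontief.

(** * Limits and cluster points of price vectors *)

Definition closeTo (n : nat) (d : R) (a q : nat -> R) : Prop :=
  forall l, (l < n)%nat -> Rabs (a l - q l) < d.

Lemma closeTo_weaken n d d' a q : d <= d' -> closeTo n d a q -> closeTo n d' a q.
Proof. intros Hd H l Hl. specialize (H l Hl). lra. Qed.

Definition infinitelyOften (Q : nat -> Prop) : Prop :=
  forall N0, exists N, (N0 <= N)%nat /\ Q N.

(** Bolzano-Weierstrass coordinate by coordinate. Carrying [Q] along yields cluster points of chosen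
    subsequences, such as events far from a given point or events at which demand crosses a
    level. *)
Lemma cluster_point n (a : nat -> nat -> R) B (Q : nat -> Prop) :
  (forall N l, (l < n)%nat -> - B <= a N l <= B) -> infinitelyOften Q ->
  exists q, forall eps, 0 < eps -> infinitelyOften (fun N => Q N /\ closeTo n eps (a N) q).
Proof.
  intros Hbd HQ. induction n as [|n IH].
  - exists (fun _ => 0). intros eps _ N0. destruct (HQ N0) as [N [HN HQN]].
    exists N. repeat split; auto. intros l Hl; lia.
  - destruct IH as [q Hq]; [intros; apply Hbd; lia|].
    assert (Hsub : forall r : nat, exists N, (r <= N)%nat /\ Q N /\ closeTo n (/ (INR r + 1)) (a N) q).
    { intros r. pose proof (pos_INR r).
      destruct (Hq (/ (INR r + 1)) ltac:(apply Rinv_0_lt_compat; lra) r) as (N & H1 & H2 & H3). eauto. }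
    (* A sequence tending to [q] in the first [n] coordinates; the last coordinate is then clustered
       along it. *)
    set (s := fun r => proj1_sig (constructive_indefinite_description _ (Hsub r))).
    assert (Hs : forall r, (r <= s r)%nat /\ Q (s r) /\ closeTo n (/ (INR r + 1)) (a (s r)) q).
    { intros r. unfold s. now destruct (constructive_indefinite_description _ (Hsub r)). }
    destruct (Bolzano_Weierstrass (fun r => a (s r) n) (fun y => - B <= y <= B))
      as [y Hy]; [apply compact_P3|intros r; apply Hbd; lia|].
    exists (fun l => if Nat.eqb l n then y else q l). intros eps Heps N0.
    destruct (INR_unbounded (/ eps)) as [r0 Hr0].
    destruct (Hy (disc y (mkposreal eps Heps)) (Nat.max N0 r0)) as [r [Hr Hd]].
    { exists (mkposreal eps Heps). intros z Hz; exact Hz. }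
    destruct (Hs r) as (H1 & H2 & H3). exists (s r). split; [lia|]. split; [auto|].
    intros l Hl. destruct (Nat.eqb_spec l n) as [->|E]; [exact Hd|].
    eapply Rlt_trans; [apply H3; lia|].
    assert (INR r0 <= INR r) by (apply le_INR; lia).
    pose proof (Rinv_0_lt_compat eps Heps).
    rewrite <- (Rinv_inv eps). apply Rinv_lt_contravar; [|lra]. apply Rmult_lt_0_compat; lra.
Qed.

(** * Continuity of demands *)

Definition tendsAt (n : nat) (F : (nat -> R) -> R) (q : nat -> R) (v : R) : Prop :=
  forall eps, 0 < eps -> exists d, 0 < d /\ forall a, closeTo n d a q -> Rabs (F a - v) < eps.

Lemma tendsAt_const n q v : tendsAt n (fun _ => v) q v.
Proof. intros eps Heps. exists 1. split; [lra|]. intros. rewrite Rminus_diag, Rabs_R0. auto. Qed.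

Lemma tendsAt_plus n F G q u v : tendsAt n F q u -> tendsAt n G q v ->
  tendsAt n (fun a => F a + G a) q (u + v).
Proof.
  intros HF HG eps Heps.
  destruct (HF (eps / 2) ltac:(lra)) as [d1 [D1 H1]].
  destruct (HG (eps / 2) ltac:(lra)) as [d2 [D2 H2]].
  exists (Rmin d1 d2). split; [now apply Rmin_pos|]. intros a Ha.
  specialize (H1 a (closeTo_weaken _ _ _ _ _ (Rmin_l d1 d2) Ha)).
  specialize (H2 a (closeTo_weaken _ _ _ _ _ (Rmin_r d1 d2) Ha)).
  replace (F a + G a - (u + v)) with ((F a - u) + (G a - v)) by ring.
  eapply Rle_lt_trans; [apply Rabs_triang|lra].
Qed.

Lemma tendsAt_rsum n m (F : nat -> (nat -> R) -> R) q v :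
  (forall i, (i < m)%nat -> tendsAt n (F i) q (v i)) ->
  tendsAt n (fun a => rsum m (fun i => F i a)) q (rsum m v).
Proof.
  induction m as [|m IH]; intros H; simpl; [apply tendsAt_const|].
  apply tendsAt_plus; auto.
Qed.

Lemma tendsAt_scal n k F q v : tendsAt n F q v -> tendsAt n (fun a => k * F a) q (k * v).
Proof.
  intros HF eps Heps. pose proof (Rabs_pos k).
  destruct (HF (eps / (Rabs k + 1)) ltac:(apply Rdiv_lt_0_compat; lra)) as [d [D HD]].
  exists d. split; auto. intros a Ha. specialize (HD a Ha).
  rewrite <- Rmult_minus_distr_l, Rabs_mult.
  apply Rle_lt_trans with (Rabs k * (eps / (Rabs k + 1))); [apply Rmult_le_compat_l; lra|].
  apply Rmult_lt_reg_r with (Rabs k + 1); [lra|].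
  replace (Rabs k * (eps / (Rabs k + 1)) * (Rabs k + 1)) with (Rabs k * eps) by (field; lra). nra.
Qed.

Lemma tendsAt_inv n F q v : 0 < v -> tendsAt n F q v -> tendsAt n (fun a => / F a) q (/ v).
Proof.
  intros Hv HF eps Heps.
  destruct (HF (Rmin (v / 2) (eps * (v * v) / 2))) as [d [D HD]].
  { apply Rmin_pos; [lra|]. assert (0 < eps * (v * v)) by (repeat apply Rmult_lt_0_compat; lra). lra. }
  exists d. split; auto. intros a Ha. specialize (HD a Ha).
  assert (H1 : Rabs (F a - v) < v / 2) by (eapply Rlt_le_trans; [apply HD|apply Rmin_l]).
  assert (H2 : Rabs (F a - v) < eps * (v * v) / 2) by (eapply Rlt_le_trans; [apply HD|apply Rmin_r]).
  apply Rabs_def2 in H1. assert (HFa : v / 2 < F a) by lra.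
  replace (/ F a - / v) with (- (F a - v) * / (F a * v)) by (field; lra).
  assert (HP : 0 < F a * v) by (apply Rmult_lt_0_compat; lra).
  rewrite Rabs_mult, Rabs_Ropp, (Rabs_pos_eq (/ (F a * v))) by (left; now apply Rinv_0_lt_compat).
  apply Rmult_lt_reg_r with (F a * v); auto.
  rewrite Rmult_assoc, Rinv_l, Rmult_1_r by lra.
  eapply Rlt_le_trans; [exact H2|].
  assert (v / 2 * v <= F a * v) by (apply Rmult_le_compat_r; lra).
  assert (eps * (v / 2 * v) <= eps * (F a * v)) by (apply Rmult_le_compat_l; lra). lra.
Qed.

Lemma tendsAt_coord n q k : (k < n)%nat -> tendsAt n (fun a => a k) q (q k).
Proof. intros Hk eps Heps. exists eps. auto. Qed.

Lemma finite_pos_lower n (Q : nat -> Prop) (f : nat -> R) :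
  (forall l, (l < n)%nat -> Q l -> 0 < f l) ->
  exists d, 0 < d /\ forall l, (l < n)%nat -> Q l -> d <= f l.
Proof.
  induction n as [|n IH]; intros H; [exists 1; split; [lra|intros; lia]|].
  destruct IH as [d [Hd H1]]; [intros l Hl; apply H; lia|].
  destruct (classic (Q n)) as [HQ|HQ].
  - exists (Rmin d (f n)). split; [apply Rmin_pos; auto|].
    intros l Hl Ql. destruct (Nat.eq_dec l n) as [->|E]; [apply Rmin_r|].
    eapply Rle_trans; [apply Rmin_l|]. apply H1; [lia|auto].
  - exists d. split; auto. intros l Hl Ql. destruct (Nat.eq_dec l n) as [->|E]; [contradiction|].
    apply H1; [lia|auto].
Qed.

(** Continuity is read off from [demand_ratio]: near [q] the wanted prices are bounded away from 0,
    so closeness in distance gives closeness in ratio. *)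
Lemma tendsAt_demand n w c e q j :
  0 <= c <= 1 -> (forall k, (k < n)%nat -> 0 <= w k) -> (exists k, (k < n)%nat /\ 0 < w k) -> 0 < e ->
  wantedPos n w q -> (j < n)%nat -> tendsAt n (fun a => demand n w c e a j) q (demand n w c e q j).
Proof.
  intros Hc Hw Hwp He Hq Hj eps Heps.
  assert (Hx : 0 <= demand n w c e q j) by (now apply demand_nonneg).
  set (x := demand n w c e q j) in *.
  (* With ratio [1 + h] each demand is at most [1 + 3h] times the other, so they differ by at most
     [3h(1 + 3h)x <= 12hx]. *)
  set (h := Rmin 1 (eps / (12 * (x + 1)))).
  assert (Hh : 0 < h) by (apply Rmin_pos; [lra|apply Rdiv_lt_0_compat; lra]).
  assert (Hh1 : h <= 1) by apply Rmin_l.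
  assert (Hhx : 12 * h * x < eps).
  { assert (h <= eps / (12 * (x + 1))) by apply Rmin_r.
    assert (12 * (x + 1) * h <= eps).
    { replace eps with (12 * (x + 1) * (eps / (12 * (x + 1)))) by (field; lra).
      apply Rmult_le_compat_l; lra. }
    lra. }
  destruct (finite_pos_lower n (fun k => 0 < w k) q) as [b [Hb Hqb]]; [intros; apply Hq; auto|].
  exists (h * b / 2). split; [assert (0 < h * b) by (now apply Rmult_lt_0_compat); lra|].
  intros a Ha.
  assert (Hwi : within n w (1 + h) q a).
  { intros k Hk Hwk. specialize (Ha k Hk). specialize (Hqb k Hk Hwk). apply Rabs_def2 in Ha.
    assert (h * b <= h * q k) by (apply Rmult_le_compat_l; lra).
    assert (h * q k <= 1 * q k) by (apply Rmult_le_compat_r; lra).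
    repeat split; try lra. nra. }
  pose proof (demand_ratio n w c e Hc Hw Hwp He (1 + h) q a j ltac:(lra) Hwi Hj) as D1.
  pose proof (demand_ratio n w c e Hc Hw Hwp He (1 + h) a q j ltac:(lra) (within_sym _ _ _ _ _ Hwi) Hj) as D2.
  fold x in D1, D2.
  assert (Ha0 : 0 <= demand n w c e a j) by (now apply demand_nonneg).
  set (y := demand n w c e a j) in *.
  assert (Hrr : (1 + h) * (1 + h) <= 1 + 3 * h) by nra.
  assert (y <= (1 + 3 * h) * x) by nra.
  assert (x <= (1 + 3 * h) * y) by nra.
  assert (0 <= h * x) by (apply Rmult_le_pos; lra).
  assert (h * (3 * y) <= h * (3 * ((1 + 3 * h) * x))) by (apply Rmult_le_compat_l; lra).
  assert (h * (h * x) <= 1 * (h * x)) by (apply Rmult_le_compat_r; lra).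
  apply Rabs_def1; lra.
Qed.

Lemma tendsAt_leontief n w e q j : 0 < bundleCost n w q ->
  tendsAt n (fun a => leontief_demand n e w a j) q (leontief_demand n e w q j).
Proof.
  intros Hq. unfold leontief_demand, Rdiv. apply tendsAt_scal, tendsAt_inv; auto.
  unfold bundleCost. apply (tendsAt_rsum n n (fun k a => w k * a k)).
  intros k Hk. now apply tendsAt_scal, tendsAt_coord.
Qed.

Lemma tendsAt_bundleCost n w q : tendsAt n (bundleCost n w) q (bundleCost n w q).
Proof.
  unfold bundleCost. apply (tendsAt_rsum n n (fun k a => w k * a k)).
  intros k Hk. now apply tendsAt_scal, tendsAt_coord.
Qed.

(** Meant for the supports of a sequence of limit points: [n] goods admit finitely many patterns, so
    one of them recurs. *)
Lemma infinite_pigeonhole n (s : nat -> nat -> Prop) :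
  exists Q, infinitelyOften Q /\
    forall r r', Q r -> Q r' -> forall j, (j < n)%nat -> (s r j <-> s r' j).
Proof.
  induction n as [|n [Q [HQ Hs]]].
  - exists (fun _ => True). split; [intros N0; exists N0; auto|]. intros; lia.
  - destruct (classic (infinitelyOften (fun r => Q r /\ s r n))) as [Hinf|Hfin].
    + exists (fun r => Q r /\ s r n). split; auto.
      intros r r' [H1 H2] [H3 H4] j Hj. destruct (Nat.eq_dec j n) as [->|E]; [tauto|].
      apply Hs; auto; lia.
    + exists (fun r => Q r /\ ~ s r n). split.
      * apply not_all_ex_not in Hfin as [N1 HN1]. intros N0.
        destruct (HQ (Nat.max N0 N1)) as [N [HN HQN]]. exists N. split; [lia|]. split; auto.
        intros Hsn. apply HN1. exists N. split; [lia|auto].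
      * intros r r' [H1 H2] [H3 H4] j Hj. destruct (Nat.eq_dec j n) as [->|E]; [tauto|].
        apply Hs; auto; lia.
Qed.

(** * The chronological sequence of updates *)

Fixpoint argmin (n : nat) (f : nat -> R) : nat :=
  match n with
  | O => O
  | S k => if Rlt_dec (f k) (f (argmin k f)) then k else argmin k f
  end.

Lemma argmin_spec n f : (0 < n)%nat ->
  (argmin n f < n)%nat /\ forall j, (j < n)%nat -> f (argmin n f) <= f j.
Proof.
  induction n as [|n IH]; intros Hn; [lia|].
  destruct (Nat.eq_dec n 0) as [->|Hne].
  - simpl. destruct (Rlt_dec (f 0%nat) (f 0%nat)); split; try lia;
      intros j Hj; replace j with 0%nat by lia; lra.
  - destruct (IH ltac:(lia)) as [H1 H2]. simpl.
    destruct (Rlt_dec (f n) (f (argmin n f))); split; try lia;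
      intros j Hj; (destruct (Nat.eq_dec j n) as [->|]; [lra|]);
      specialize (H2 j ltac:(lia)); lra.
Qed.

Lemma finite_upper_bound n (f : nat -> nat -> R) :
  (forall l, (l < n)%nat -> exists C, forall N, f N l <= C) ->
  exists C, forall l, (l < n)%nat -> forall N, f N l <= C.
Proof.
  induction n as [|n IH]; intros H; [exists 0; intros; lia|].
  destruct IH as [C1 H1]; [intros l Hl; apply H; lia|].
  destruct (H n ltac:(lia)) as [C2 H2]. exists (Rmax C1 C2). intros l Hl N.
  destruct (Nat.eq_dec l n) as [->|E].
  - eapply Rle_trans; [apply H2|apply Rmax_r].
  - eapply Rle_trans; [apply H1; lia|apply Rmax_l].
Qed.

Lemma rsum_bounded n (f : nat -> nat -> R) :
  (forall l, (l < n)%nat -> exists C, forall N, f N l <= C) ->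
  exists C, forall N, rsum n (f N) <= C.
Proof.
  intros H. destruct (finite_upper_bound n f H) as [C HC].
  exists (rsum n (fun _ => C)). intros N. apply rsum_le. auto.
Qed.

Lemma least_index (Q : nat -> Prop) :
  (exists N, Q N) -> exists N, Q N /\ forall M, (M < N)%nat -> ~ Q M.
Proof.
  intros [N HN]. induction N as [N IH] using lt_wf_ind.
  destruct (classic (exists M, (M < N)%nat /\ Q M)) as [[M [HM HQ]]|Hno].
  - now apply IH with M.
  - exists N. split; [auto|]. intros M HM HQ. apply Hno. eauto.
Qed.

Lemma rsum_range_le F G M N : (M <= N)%nat ->
  (forall r, (M <= r < N)%nat -> F r <= G r) ->
  rsum N F - rsum M F <= rsum N G - rsum M G.
Proof.
  intros HMN. induction HMN as [|N HMN IH]; intros H; [lra|]. simpl.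
  assert (rsum N F - rsum M F <= rsum N G - rsum M G) by (apply IH; intros; apply H; lia).
  assert (F N <= G N) by (apply H; lia). lra.
Qed.

Section Tatonnement.
Variables (n m : nat) (e : nat -> R) (w : nat -> nat -> R) (c : nat -> R) (lambda : R)
  (T P zt : nat -> nat -> R) (p : R -> nat -> R).

Definition totalDemand (q : nat -> R) (j : nat) : R :=
  rsum m (fun i => demand n (w i) (c i) (e i) q j).

Hypothesis Hn : (0 < n)%nat.
Hypothesis Hlam : 0 < lambda /\ lambda <= 100 / 2346.
Hypothesis He : forall i, (i < m)%nat -> 0 < e i.
Hypothesis Hc : forall i, (i < m)%nat -> 0 <= c i <= 1.
Hypothesis Hw : forall i, (i < m)%nat -> forall j, (j < n)%nat -> 0 <= w i j.
Hypothesis Hwpos : forall i, (i < m)%nat -> exists j, (j < n)%nat /\ 0 < w i j.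
Hypothesis Hinit : forall j, (j < n)%nat -> 0 < P j O.
Hypothesis Htimes : forall j, (j < n)%nat ->
       (0 < T j O <= 1) /\
       (forall k, T j k < T j (S k) <= T j k + 1) /\
       (forall M, exists k, M < T j k).
Hypothesis Hdistinct : forall j j' k k', (j < n)%nat -> (j' < n)%nat ->
       T j k = T j' k' -> j = j' /\ k = k'.
Hypothesis Htraj : forall j, (j < n)%nat ->
       (forall t, 0 <= t <= T j O -> p t j = P j O) /\
       (forall k t, T j k < t <= T j (S k) -> p t j = P j (S k)).
Hypothesis Hzt : forall j k, (j < n)%nat ->
       exists t1 t2,
         prev_time T j k < t1 <= T j k /\ prev_time T j k < t2 <= T j k /\
         ((forall l, (l < n)%nat -> 0 < p t1 l) -> (forall l, (l < n)%nat -> 0 < p t2 l) ->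
          totalDemand (p t1) j - 1 <= zt j k <= totalDemand (p t2) j - 1).
Hypothesis Hupdate : forall j k, (j < n)%nat ->
       P j (S k) = P j k * (1 + lambda * Rmin (zt j k) 1 * (T j k - prev_time T j k)).

(* All updates are merged into one chronological sequence: [updates N j] counts the updates of
   good [j] among the first [N], and event [N] (counted from 0) updates good [updated N].  The values
   indexed by [N] below are those just before event [N]. *)
Fixpoint updates (N : nat) : nat -> nat :=
  match N with
  | O => fun _ => O
  | S N' => fun l =>
      if Nat.eqb l (argmin n (fun i => T i (updates N' i))) then S (updates N' l)
      else updates N' l
  end.

Definition updated (N : nat) : nat := argmin n (fun l => T l (updates N l)).
Definition eventTime (N : nat) : R := T (updated N) (updates N (updated N)).
Definition lastTime (N l : nat) : R := prev_time T l (updates N l).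
Definition price (N l : nat) : R := P l (updates N l).
Definition gap (N : nat) : R := eventTime N - lastTime N (updated N).
Definition signal (N : nat) : R := zt (updated N) (updates N (updated N)).
Definition clipped (N : nat) : R := Rmin (signal N) 1.
Definition relChange (N : nat) : R := lambda * clipped N * gap N.

Lemma updated_lt N : (updated N < n)%nat.
Proof. now apply argmin_spec. Qed.

Lemma eventTime_le N l : (l < n)%nat -> eventTime N <= T l (updates N l).
Proof. intros Hl. now apply (argmin_spec n (fun l => T l (updates N l))). Qed.

Lemma updates_S N l :
  updates (S N) l = if Nat.eqb l (updated N) then S (updates N l) else updates N l.
Proof. reflexivity. Qed.

Lemma updates_S_same N : updates (S N) (updated N) = S (updates N (updated N)).
Proof. rewrite updates_S, Nat.eqb_refl. reflexivity. Qed.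

Lemma updates_S_other N l : l <> updated N -> updates (S N) l = updates N l.
Proof. intros H. rewrite updates_S. apply Nat.eqb_neq in H. now rewrite H. Qed.

Lemma updates_mono M N l : (M <= N)%nat -> (updates M l <= updates N l)%nat.
Proof.
  induction 1 as [|N _ IH]; [lia|]. rewrite updates_S.
  destruct (Nat.eqb l (updated N)); lia.
Qed.

Lemma T_mono l k k' : (l < n)%nat -> (k <= k')%nat -> T l k <= T l k'.
Proof.
  intros Hl. induction 1 as [|k' _ IH]; [lra|].
  destruct (Htimes l Hl) as (_ & H & _). specialize (H k'). lra.
Qed.

Lemma eventTime_S N : eventTime N < eventTime (S N).
Proof.
  pose proof (updated_lt N) as H1. pose proof (updated_lt (S N)) as H2.
  unfold eventTime at 2. set (j := updated (S N)) in *.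
  destruct (Nat.eq_dec j (updated N)) as [E|E].
  - rewrite E, updates_S_same. now apply Htimes.
  - rewrite updates_S_other by auto.
    destruct (Rle_lt_or_eq_dec _ _ (eventTime_le N j H2)) as [H|H]; auto.
    unfold eventTime in H. apply Hdistinct in H as [H _]; auto. congruence.
Qed.

Lemma eventTime_mono M N : (M <= N)%nat -> eventTime M <= eventTime N.
Proof. induction 1 as [|N _ IH]; [lra|]. pose proof (eventTime_S N). lra. Qed.

Lemma lastTime_S_same N : lastTime (S N) (updated N) = eventTime N.
Proof. unfold lastTime. now rewrite updates_S_same. Qed.

Lemma lastTime_S_other N l : l <> updated N -> lastTime (S N) l = lastTime N l.
Proof. intros H. unfold lastTime. now rewrite updates_S_other. Qed.

Lemma eventTime_pos N : 0 < eventTime N.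
Proof.
  assert (H : 0 < eventTime 0) by (apply (proj1 (Htimes _ (updated_lt 0)))).
  pose proof (eventTime_mono 0 N ltac:(lia)). lra.
Qed.

Lemma lastTime_lt N l : (l < n)%nat -> lastTime N l < eventTime N.
Proof.
  intros Hl. induction N as [|N IH]; [apply eventTime_pos|].
  pose proof (eventTime_S N) as H.
  destruct (Nat.eq_dec l (updated N)) as [->|E].
  - now rewrite lastTime_S_same.
  - rewrite lastTime_S_other by auto. lra.
Qed.

Lemma lastTime_S_le N l : (l < n)%nat -> lastTime (S N) l <= eventTime N.
Proof.
  intros Hl. destruct (Nat.eq_dec l (updated N)) as [->|E].
  - rewrite lastTime_S_same; lra.
  - rewrite lastTime_S_other by auto. left. now apply lastTime_lt.
Qed.

Lemma lastTime_ge N l : (l < n)%nat -> eventTime N - 1 <= lastTime N l.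
Proof.
  intros Hl. pose proof (eventTime_le N l Hl). unfold lastTime.
  destruct (Htimes l Hl) as (H0 & H1 & _).
  destruct (updates N l) as [|k]; simpl; [lra|]. specialize (H1 k). lra.
Qed.

Lemma gap_range N : 0 < gap N <= 1.
Proof.
  unfold gap. pose proof (lastTime_lt N _ (updated_lt N)).
  pose proof (lastTime_ge N _ (updated_lt N)). lra.
Qed.

Lemma lastTime_S N l : lastTime (S N) l = lastTime N l + (if Nat.eqb l (updated N) then gap N else 0).
Proof.
  destruct (Nat.eqb_spec l (updated N)) as [->|E].
  - rewrite lastTime_S_same. unfold gap. ring.
  - rewrite lastTime_S_other by auto. ring.
Qed.

Lemma lastTime_mono M N l : (M <= N)%nat -> lastTime M l <= lastTime N l.
Proof.
  induction 1 as [|N _ IH]; [lra|]. rewrite lastTime_S. pose proof (gap_range N).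
  destruct (Nat.eqb l (updated N)); lra.
Qed.

Lemma updates_total N : rsum n (fun l => INR (updates N l)) = INR N.
Proof.
  induction N as [|N IH].
  - simpl. apply rsum_zero.
  - rewrite (rsum_update n (fun l => INR (updates N l)) _ (updated N) (updated_lt N)).
    + rewrite IH, updates_S_same, !S_INR. ring.
    + intros j Hj Hne. now rewrite updates_S_other.
Qed.

(** There is no minimal gap between events. Instead, each good has finitely many updates up to time
    [B], and the counters of all goods add up to the number of events. *)
Lemma eventTime_unbounded B : exists N, B < eventTime N.
Proof.
  apply NNPP. intros Hno.
  assert (Hle : forall N, eventTime N <= B) by (intros N; apply Rnot_lt_le; eauto).
  destruct (rsum_bounded n (fun N l => INR (updates N l))) as [C HC].
  - intros l Hl. destruct (Htimes l Hl) as (_ & _ & H). destruct (H B) as [k Hk].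
    exists (INR k). intros N. apply le_INR, Nat.nlt_ge. intros Hlt.
    pose proof (lastTime_lt N l Hl) as H1. unfold lastTime in H1.
    destruct (updates N l) as [|k'] eqn:E; [lia|]. simpl in H1.
    pose proof (T_mono l k k' Hl ltac:(lia)). specialize (Hle N). lra.
  - destruct (INR_unbounded C) as [N HN]. specialize (HC N). rewrite updates_total in HC. lra.
Qed.

(** [M] is the first event at or after [t]. Since [p] gives the price just before an update, an
    event time itself belongs to that event. *)
Lemma price_of_time t : 0 <= t ->
  exists M, t <= eventTime M /\ (forall M', (M' < M)%nat -> eventTime M' < t) /\
    forall l, (l < n)%nat -> p t l = price M l.
Proof.
  intros Ht. destruct (least_index (fun N => t <= eventTime N)) as [M [HM Hmin]].
  { destruct (eventTime_unbounded t) as [N HN]. exists N. lra. }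
  assert (Hmin' : forall M', (M' < M)%nat -> eventTime M' < t)
    by (intros M' H; apply Rnot_le_lt; auto).
  exists M. split; [auto|]. split; [auto|].
  intros l Hl. destruct (Htraj l Hl) as [H0 H1]. unfold price.
  pose proof (eventTime_le M l Hl) as H2.
  destruct (updates M l) as [|k] eqn:E; [apply H0; lra|].
  apply H1. split; [|lra]. destruct M as [|M]; [discriminate|].
  pose proof (lastTime_S_le M l Hl) as H3. unfold lastTime in H3. rewrite E in H3. simpl in H3.
  specialize (Hmin' M ltac:(lia)). lra.
Qed.

(* [l] is not updated from event [M] up to event [N]; at an update of [l], these are the events [M]
   whose demands may enter the signal. *)
Definition sameEpoch (l M N : nat) : Prop := (M <= N)%nat /\ updates M l = updates N l.

Lemma epoch_of_time N t : lastTime N (updated N) < t <= eventTime N ->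
  exists M, sameEpoch (updated N) M N /\ forall l, (l < n)%nat -> p t l = price M l.
Proof.
  intros [H1 H2]. pose proof (updated_lt N) as Hj. set (j := updated N) in *.
  assert (Ht : 0 <= t).
  { pose proof (lastTime_mono 0 N j ltac:(lia)) as H. unfold lastTime at 1 in H. simpl in H. lra. }
  destruct (price_of_time t Ht) as (M & HM & Hmin & Hp). exists M. split; [|auto].
  assert (HMN : (M <= N)%nat).
  { apply Nat.nlt_ge. intros Hlt. specialize (Hmin N Hlt). lra. }
  split; [auto|]. pose proof (updates_mono M N j HMN) as Hle.
  apply Nat.le_antisymm; auto. apply Nat.nlt_ge. intros Hlt.
  pose proof (eventTime_le M j Hj) as H3. unfold lastTime in H1.
  destruct (updates N j) as [|k]; [lia|]. simpl in H1.
  pose proof (T_mono j (updates M j) k Hj ltac:(lia)). lra.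
Qed.

Lemma totalDemand_ext q q' j : (forall k, (k < n)%nat -> q k = q' k) -> (j < n)%nat ->
  totalDemand q j = totalDemand q' j.
Proof. intros H Hj. apply rsum_ext. intros i Hi. now apply demand_ext. Qed.

Lemma totalDemand_nonneg q j : (j < n)%nat -> 0 <= totalDemand q j.
Proof. intros Hj. apply rsum_nonneg. intros i Hi. apply demand_nonneg; auto. Qed.

Lemma price_changed N : changed n (updated N) (relChange N) (price N) (price (S N)).
Proof.
  split.
  - unfold price. rewrite updates_S_same, Hupdate by apply updated_lt. reflexivity.
  - intros l Hl E. unfold price. now rewrite updates_S_other.
Qed.

Lemma signal_bounds_if_positive N : exists M1 M2,
  sameEpoch (updated N) M1 N /\ sameEpoch (updated N) M2 N /\
  ((forall l, (l < n)%nat -> 0 < price M1 l) -> (forall l, (l < n)%nat -> 0 < price M2 l) ->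
   totalDemand (price M1) (updated N) - 1 <= signal N <= totalDemand (price M2) (updated N) - 1).
Proof.
  pose proof (updated_lt N) as Hj.
  destruct (Hzt (updated N) (updates N (updated N)) Hj) as (t1 & t2 & H1 & H2 & H3).
  destruct (epoch_of_time N t1 H1) as (M1 & HM1 & E1).
  destruct (epoch_of_time N t2 H2) as (M2 & HM2 & E2).
  exists M1, M2. split; [auto|]. split; [auto|]. intros P1 P2.
  rewrite (totalDemand_ext _ _ _ E1 Hj), (totalDemand_ext _ _ _ E2 Hj) in H3.
  apply H3; intros l Hl; [rewrite E1|rewrite E2]; auto.
Qed.

(** Breaks a circle: the signal is bounded by known demands only at positive prices, and prices stay
    positive because the signal is at least -1. Strong induction works since the signal at event [N]
    refers to prices up to event [N]. *)
Lemma price_pos N l : (l < n)%nat -> 0 < price N l.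
Proof.
  revert l. induction N as [[|N] IH] using lt_wf_ind; intros l Hl; [now apply Hinit|].
  destruct (price_changed N) as [H1 H2].
  destruct (Nat.eq_dec l (updated N)) as [->|E]; [|rewrite H2 by auto; apply IH; [lia|auto]].
  assert (Hs : -1 <= signal N).
  { destruct (signal_bounds_if_positive N) as (M1 & M2 & [HM1 _] & [HM2 _] & H).
    destruct H as [H _]; [intros; apply IH; auto; lia|intros; apply IH; auto; lia|].
    pose proof (totalDemand_nonneg (price M1) (updated N) Hl). lra. }
  assert (Hr : -1 < relChange N).
  { assert (Hcl : -1 <= clipped N) by (apply Rmin_glb; lra).
    unfold relChange. pose proof (gap_range N).
    assert (lambda * gap N <= lambda * 1) by (apply Rmult_le_compat_l; lra).
    assert (0 < lambda * gap N) by (apply Rmult_lt_0_compat; lra). nra. }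
  rewrite H1. apply Rmult_lt_0_compat; [apply IH; [lia|auto]|lra].
Qed.

Lemma signal_bounds N : exists M1 M2,
  sameEpoch (updated N) M1 N /\ sameEpoch (updated N) M2 N /\
  totalDemand (price M1) (updated N) - 1 <= signal N <= totalDemand (price M2) (updated N) - 1.
Proof.
  destruct (signal_bounds_if_positive N) as (M1 & M2 & H1 & H2 & H3).
  exists M1, M2. split; [auto|]. split; [auto|]. apply H3; intros; now apply price_pos.
Qed.

Lemma signal_ge N : -1 <= signal N.
Proof.
  destruct (signal_bounds N) as (M1 & M2 & _ & _ & H & _).
  pose proof (totalDemand_nonneg (price M1) (updated N) (updated_lt N)). lra.
Qed.

Lemma clipped_range N : -1 <= clipped N <= 1.
Proof.
  unfold clipped. split; [apply Rmin_glb; [apply signal_ge|lra]|apply Rmin_r].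
Qed.

Lemma relChange_abs N : Rabs (relChange N) = lambda * Rabs (clipped N) * gap N.
Proof.
  unfold relChange. pose proof (gap_range N). rewrite !Rabs_mult, (Rabs_pos_eq lambda), (Rabs_pos_eq (gap N)); lra.
Qed.

Lemma clipped_abs N : Rabs (clipped N) <= 1.
Proof. apply Rabs_le. apply clipped_range. Qed.

Lemma relChange_le N : Rabs (relChange N) <= lambda * gap N.
Proof.
  rewrite relChange_abs. pose proof (gap_range N). pose proof (clipped_abs N).
  assert (0 < lambda * gap N) by (apply Rmult_lt_0_compat; lra). nra.
Qed.

Lemma relChange_small N : Rabs (relChange N) <= 1/23.
Proof.
  pose proof (relChange_le N). pose proof (gap_range N).
  assert (lambda * gap N <= lambda * 1) by (apply Rmult_le_compat_l; lra). lra.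
Qed.

Lemma relChange_range N : - (1/23) <= relChange N <= 1/23.
Proof.
  pose proof (relChange_small N) as H. split.
  - pose proof (Rle_abs (- relChange N)) as H1. rewrite Rabs_Ropp in H1. lra.
  - pose proof (Rle_abs (relChange N)). lra.
Qed.

Lemma sameEpoch_price l M N : sameEpoch l M N -> price M l = price N l.
Proof. intros [_ H]. unfold price. now rewrite H. Qed.

Lemma price_wanted i N : wantedPos n (w i) (price N).
Proof. intros j Hj _. now apply price_pos. Qed.

Lemma spending_le q j : (forall l, (l < n)%nat -> 0 < q l) -> (j < n)%nat ->
  q j * totalDemand q j <= rsum m e.
Proof.
  intros Hq Hj. unfold totalDemand. rewrite <- rsum_scal. apply rsum_le. intros i Hi.
  apply Rle_trans with (rsum n (fun j => q j * demand n (w i) (c i) (e i) q j)).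
  - apply (rsum_term_le n (fun j => q j * demand n (w i) (c i) (e i) q j)); auto.
    intros l Hl. apply Rmult_le_pos; [left; auto|]. apply demand_nonneg; auto.
  - rewrite demand_budget; auto; [lra|]. intros l Hl _; auto.
Qed.

(** A good priced above the total budget has demand below 1. Its price is constant during its epoch,
    so the signal is negative and the price falls; from below the budget, one update multiplies it
    by at most 24/23. *)
Lemma price_bounded : exists B, 0 < B /\ forall N l, (l < n)%nat -> price N l <= B.
Proof.
  assert (HE : 0 <= rsum m e) by (apply rsum_nonneg; intros i Hi; left; auto).
  assert (H0 : forall l, (l < n)%nat -> 0 <= price 0 l) by (intros; left; now apply price_pos).
  assert (HP : 0 <= rsum n (price 0)) by (now apply rsum_nonneg).
  exists (rsum n (price 0) + 2 * rsum m e + 1). split; [lra|].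
  intros N l Hl. induction N as [|N IH].
  - pose proof (rsum_term_le n (price 0) l H0 Hl). lra.
  - destruct (price_changed N) as [H1 H2].
    destruct (Nat.eq_dec l (updated N)) as [->|E]; [|now rewrite H2].
    rewrite H1. pose proof (relChange_range N) as Hr. pose proof (price_pos N _ Hl) as Hpp.
    destruct (Rle_lt_dec (price N (updated N)) (rsum m e)) as [Hs|Hb]; [nra|].
    destruct (signal_bounds N) as (_ & M & _ & HM & _ & Hz).
    pose proof (spending_le (price M) (updated N) (fun l => price_pos M l) Hl) as Hsp.
    rewrite (sameEpoch_price _ _ _ HM) in Hsp.
    assert (Hlt : totalDemand (price M) (updated N) < 1).
    { apply Rnot_le_lt. intros H. nra. }
    assert (Hd : clipped N < 0) by (unfold clipped; eapply Rle_lt_trans; [apply Rmin_l|lra]).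
    assert (relChange N <= 0).
    { unfold relChange. pose proof (gap_range N).
      assert (0 < lambda * gap N) by (apply Rmult_lt_0_compat; lra). nra. }
    nra.
Qed.

(** * Amortised descent of the potential *)

Definition phi (q : nat -> R) : R :=
  rsum n q + rsum m (fun i => potential n (w i) (c i) (e i) q).

Lemma phi_step N : phi (price (S N)) - phi (price N) <=
  - (totalDemand (price (S N)) (updated N) - 1) * (price N (updated N) * relChange N).
Proof.
  pose proof (updated_lt N) as Hj. set (j := updated N) in *.
  pose proof (price_changed N) as Hch. fold j in Hch.
  pose proof (relChange_range N) as Hr. pose proof (price_pos N j Hj) as Hpp.
  unfold phi.
  rewrite (rsum_update n (price N) (price (S N)) j Hj) by (apply Hch).
  assert (Hd : price (S N) j - price N j = price N j * relChange N)
    by (rewrite (proj1 Hch); ring).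
  assert (Hpot : rsum m (fun i => potential n (w i) (c i) (e i) (price (S N))) -
                 rsum m (fun i => potential n (w i) (c i) (e i) (price N)) <=
                 - totalDemand (price (S N)) j * (price (S N) j - price N j)).
  { rewrite <- rsum_minus. unfold totalDemand.
    rewrite Ropp_mult_distr_l_reverse, Rmult_comm, Ropp_mult_distr_l, <- rsum_scal.
    apply rsum_le. intros i Hi.
    pose proof (potential_step n (w i) (c i) (e i) (Hc i Hi) (Hw i Hi) (Hwpos i Hi) (He i Hi)
                  j (relChange N) (price N) (price (S N)) Hj (price_wanted i N) (price_wanted i (S N)) Hch). lra. }
  rewrite Hd in Hpot. lra.
Qed.

(** Governs how the demand for [l] reacts to a relative change of the price of [k]. Times the price
    of [l] it is symmetric in the two goods, so an error can be charged at either end: its sum over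
    [k] is the demand for [l], its price-weighted sum over [l] the spending on [k]. *)
Definition coupling (N l k : nat) : R :=
  rsum m (fun i => demand n (w i) (c i) (e i) (price N) l *
                   (price N k * demand n (w i) (c i) (e i) (price N) k / e i)).

Lemma share_nonneg i N k : (i < m)%nat -> (k < n)%nat ->
  0 <= price N k * demand n (w i) (c i) (e i) (price N) k / e i.
Proof.
  intros Hi Hk. pose proof (He i Hi). pose proof (price_pos N k Hk).
  apply Rmult_le_pos; [|left; now apply Rinv_0_lt_compat].
  apply Rmult_le_pos; [lra|]. apply demand_nonneg; auto.
Qed.

Lemma coupling_nonneg N l k : (l < n)%nat -> (k < n)%nat -> 0 <= coupling N l k.
Proof.
  intros Hl Hk. apply rsum_nonneg. intros i Hi.
  apply Rmult_le_pos; [apply demand_nonneg; auto|now apply share_nonneg].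
Qed.

Lemma coupling_sum N l : (l < n)%nat ->
  rsum n (fun k => coupling N l k) = totalDemand (price N) l.
Proof.
  intros Hl. unfold coupling. rewrite rsum_swap. apply rsum_ext. intros i Hi.
  rewrite rsum_scal.
  rewrite (rsum_ext n (fun k => price N k * demand n (w i) (c i) (e i) (price N) k / e i)
             (fun k => / e i * (price N k * demand n (w i) (c i) (e i) (price N) k)))
    by (intros; unfold Rdiv; ring).
  rewrite rsum_scal, demand_budget; auto using price_wanted.
  pose proof (He i Hi). field. lra.
Qed.

Lemma coupling_spending N k : (k < n)%nat ->
  rsum n (fun l => price N l * coupling N l k) = price N k * totalDemand (price N) k.
Proof.
  intros Hk. unfold coupling, totalDemand.
  rewrite (rsum_ext n _ (fun l => rsum m (fun i => price N l * (demand n (w i) (c i) (e i) (price N) l *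
                   (price N k * demand n (w i) (c i) (e i) (price N) k / e i)))))
    by (intros; now rewrite rsum_scal).
  rewrite rsum_swap, <- rsum_scal. apply rsum_ext. intros i Hi.
  rewrite (rsum_ext n _ (fun l => price N k * demand n (w i) (c i) (e i) (price N) k / e i *
      (price N l * demand n (w i) (c i) (e i) (price N) l))) by (intros; ring).
  rewrite rsum_scal, demand_budget; auto using price_wanted.
  pose proof (He i Hi). field. lra.
Qed.

Lemma demand_step_other N l : (l < n)%nat -> l <> updated N ->
  Rabs (totalDemand (price (S N)) l - totalDemand (price N) l) <=
  21/20 * Rabs (relChange N) * coupling N l (updated N).
Proof.
  intros Hl Hne. unfold totalDemand, coupling. rewrite <- rsum_minus, <- rsum_scal.
  eapply Rle_trans; [apply rsum_abs_le|]. apply rsum_le. intros i Hi.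
  apply demand_changed_cross; auto using updated_lt, price_wanted, price_pos, relChange_small, price_changed.
Qed.

Lemma demand_step_own N :
  Rabs (totalDemand (price (S N)) (updated N) - totalDemand (price N) (updated N)) <=
  11/5 * Rabs (relChange N) * totalDemand (price N) (updated N).
Proof.
  unfold totalDemand. rewrite <- rsum_minus, <- rsum_scal.
  eapply Rle_trans; [apply rsum_abs_le|]. apply rsum_le. intros i Hi.
  apply demand_changed_own; auto using updated_lt, price_wanted, relChange_small, price_changed.
Qed.

Lemma sameEpoch_not_updated l M N r : sameEpoch l M N -> (M <= r < N)%nat -> l <> updated r.
Proof.
  intros [_ H] Hr ->. pose proof (updates_mono M r (updated r) ltac:(lia)).
  pose proof (updates_mono (S r) N (updated r) ltac:(lia)).
  rewrite updates_S_same in H1. lia.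
Qed.

Lemma sameEpoch_sub l M N r : sameEpoch l M N -> (M <= r <= N)%nat -> sameEpoch l r N.
Proof.
  intros [_ H] Hr. split; [lia|]. pose proof (updates_mono M r l ltac:(lia)).
  pose proof (updates_mono r N l ltac:(lia)). lia.
Qed.

Lemma demand_path l M N : (l < n)%nat -> sameEpoch l M N ->
  Rabs (totalDemand (price N) l - totalDemand (price M) l) <=
  rsum N (fun r => 21/20 * Rabs (relChange r) * coupling r l (updated r)) -
  rsum M (fun r => 21/20 * Rabs (relChange r) * coupling r l (updated r)).
Proof.
  intros Hl HE. pose proof (proj1 HE) as HMN.
  assert (Hne : forall r, (M <= r < N)%nat -> l <> updated r)
    by (intros r Hr; now apply (sameEpoch_not_updated l M N)).
  clear HE. induction HMN as [|N HMN IH].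
  - rewrite !Rminus_diag, Rabs_R0. lra.
  - simpl. pose proof (demand_step_other N l Hl (Hne N ltac:(lia))) as H1.
    assert (H2 := IH ltac:(intros; apply Hne; lia)).
    replace (totalDemand (price (S N)) l - totalDemand (price M) l) with
      ((totalDemand (price (S N)) l - totalDemand (price N) l) +
       (totalDemand (price N) l - totalDemand (price M) l)) by ring.
    eapply Rle_trans; [apply Rabs_triang|]. lra.
Qed.

(** The gaps of updates inside the epoch may begin up to one unit before it, and the epoch itself
    lasts at most one unit. *)
Lemma epoch_lastTime N M l : (l < n)%nat -> sameEpoch (updated N) M N ->
  lastTime N l - lastTime M l <= 2.
Proof.
  intros Hl [HMN HE]. pose proof (lastTime_lt N l Hl). pose proof (lastTime_ge M l Hl).
  pose proof (lastTime_lt M _ (updated_lt N)) as H1.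
  assert (E : lastTime M (updated N) = lastTime N (updated N)) by (unfold lastTime; now rewrite HE).
  pose proof (lastTime_ge N _ (updated_lt N)). lra.
Qed.

(** Each update multiplies the price by a factor between [1 - v] and [1 + v], [v = lambda * gap].
    The factors combine by [(1-u)(1-v) >= 1-u-v] and [(1+v)(1-u-v) <= 1-u], and the gaps
    telescope. *)
Lemma price_drift l M N : (l < n)%nat -> (M <= N)%nat -> lastTime N l - lastTime M l <= 2 ->
  price M l * (1 - lambda * (lastTime N l - lastTime M l)) <= price N l /\
  price N l * (1 - lambda * (lastTime N l - lastTime M l)) <= price M l.
Proof.
  intros Hl HMN. induction HMN as [|N HMN IH]; intros H2; [lra|].
  destruct (price_changed N) as [H3 H4].
  destruct (Nat.eq_dec l (updated N)) as [E|E].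
  - pose proof (lastTime_S N l) as HS. rewrite E, Nat.eqb_refl in HS. subst l.
    pose proof (gap_range N) as Hg. rewrite H3.
    destruct IH as [I1 I2]; [lra|].
    pose proof (lastTime_mono M N (updated N) HMN) as Hm.
    set (s := lastTime N (updated N) - lastTime M (updated N)) in *.
    replace (lastTime (S N) (updated N) - lastTime M (updated N)) with (s + gap N) in * by (unfold s; lra).
    pose proof (relChange_le N) as Hf.
    pose proof (price_pos N _ Hl) as P1. pose proof (price_pos M _ Hl) as P2.
    pose proof (Rle_abs (relChange N)) as A1.
    pose proof (Rle_abs (- relChange N)) as A2. rewrite Rabs_Ropp in A2.
    assert (L1 : 0 <= lambda * s) by (apply Rmult_le_pos; unfold s; lra).
    assert (L2 : 0 < lambda * gap N) by (apply Rmult_lt_0_compat; lra).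
    assert (L3 : lambda * (s + gap N) <= lambda * 2) by (apply Rmult_le_compat_l; lra).
    rewrite Rmult_plus_distr_l in *.
    set (u := lambda * s) in *. set (v := lambda * gap N) in *. set (f := relChange N) in *.
    split.
    + apply Rle_trans with (price M (updated N) * (1 - u) * (1 - v)).
      * rewrite Rmult_assoc. apply Rmult_le_compat_l; nra.
      * apply Rle_trans with (price N (updated N) * (1 - v)).
        -- apply Rmult_le_compat_r; lra.
        -- apply Rmult_le_compat_l; lra.
    + apply Rle_trans with (price N (updated N) * (1 - u)); [|lra].
      rewrite Rmult_assoc. apply Rmult_le_compat_l; [lra|]. nra.
  - rewrite H4, lastTime_S_other in * by auto. auto.
Qed.

(* An epoch and the updates made in it span at most two time units, and [1 / (1 - 2 lambda) <= 11/10]. *)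
Lemma epoch_within i N M r : sameEpoch (updated N) M N -> (M <= r <= N)%nat ->
  within n (w i) (11/10) (price r) (price N).
Proof.
  intros HE Hr k Hk _. assert (HE' := sameEpoch_sub _ _ _ _ HE Hr).
  pose proof (epoch_lastTime N r k Hk HE') as H2.
  destruct (price_drift k r N Hk ltac:(lia) H2) as [D1 D2].
  pose proof (price_pos r k Hk). pose proof (price_pos N k Hk).
  pose proof (lastTime_mono r N k ltac:(lia)).
  assert (lambda * (lastTime N k - lastTime r k) <= lambda * 2) by (apply Rmult_le_compat_l; lra).
  repeat split; auto; nra.
Qed.

Lemma epoch_demand N M : sameEpoch (updated N) M N ->
  totalDemand (price N) (updated N) <= 11/10 * totalDemand (price M) (updated N).
Proof.
  intros HE. unfold totalDemand. rewrite <- rsum_scal. apply rsum_le. intros i Hi.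
  apply demand_ratio_same; auto using updated_lt; try lra.
  - apply (epoch_within i N M M HE). destruct HE; lia.
  - symmetry. now apply sameEpoch_price.
Qed.

(** Freezes the couplings at event [N], so that sums over the epoch can be evaluated. Of the three
    factors 11/10, one is for the demand for the updated good, whose own price is fixed, and two are
    for the budget share. *)
Lemma epoch_coupling N M r k : sameEpoch (updated N) M N -> (M <= r <= N)%nat -> (k < n)%nat ->
  coupling r (updated N) k <= 1331/1000 * coupling N (updated N) k.
Proof.
  intros HE Hr Hk. unfold coupling. rewrite <- rsum_scal. apply rsum_le. intros i Hi.
  pose proof (updated_lt N) as Hj. set (j := updated N) in *.
  assert (Hwi := within_sym _ _ _ _ _ (epoch_within i N M r HE Hr)).
  assert (D1 : demand n (w i) (c i) (e i) (price r) j <= 11/10 * demand n (w i) (c i) (e i) (price N) j).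
  { apply demand_ratio_same; auto; try lra. apply sameEpoch_price.
    now apply (sameEpoch_sub j M N r). }
  assert (D2 : price r k * demand n (w i) (c i) (e i) (price r) k / e i <=
     121/100 * (price N k * demand n (w i) (c i) (e i) (price N) k / e i)).
  { pose proof (He i Hi) as Hei. unfold Rdiv at 1 3. rewrite <- Rmult_assoc.
    apply Rmult_le_compat_r; [left; now apply Rinv_0_lt_compat|].
    replace (121/100) with (11/10 * (11/10)) by lra.
    apply spending_ratio; auto; lra. }
  pose proof (share_nonneg i r k Hi Hk) as S1.
  assert (N1 : 0 <= demand n (w i) (c i) (e i) (price r) j) by (apply demand_nonneg; auto).
  replace (1331/1000) with (11/10 * (121/100)) by lra.
  eapply Rle_trans; [apply Rmult_le_compat; [exact N1|exact S1|exact D1|exact D2]|]. lra.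
Qed.

(** Regroups a sum over events by goods; the gaps of one good telescope to a difference of its
    [lastTime]. *)
Lemma gap_sum h M N : (M <= N)%nat ->
  rsum N (fun r => gap r * h (updated r)) - rsum M (fun r => gap r * h (updated r)) =
  rsum n (fun k => h k * (lastTime N k - lastTime M k)).
Proof.
  induction 1 as [|N HMN IH].
  - rewrite Rminus_diag, (rsum_ext n _ (fun _ => 0)) by (intros; ring). now rewrite rsum_zero.
  - simpl.
    rewrite (rsum_update n (fun k => h k * (lastTime N k - lastTime M k)) _ (updated N) (updated_lt N)).
    + rewrite lastTime_S, Nat.eqb_refl. lra.
    + intros k Hk E. now rewrite lastTime_S_other.
Qed.

Lemma epoch_coupling_sum N M : sameEpoch (updated N) M N ->
  rsum N (fun r => gap r * coupling r (updated N) (updated r)) -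
  rsum M (fun r => gap r * coupling r (updated N) (updated r)) <=
  2662/1000 * totalDemand (price N) (updated N).
Proof.
  intros HE. pose proof (updated_lt N) as Hj. set (j := updated N) in *.
  eapply Rle_trans.
  - apply (rsum_range_le _ (fun r => gap r * (1331/1000 * coupling N j (updated r))) M N (proj1 HE)).
    intros r Hr. pose proof (gap_range r). apply Rmult_le_compat_l; [lra|].
    apply (epoch_coupling N M r); auto using updated_lt. lia.
  - rewrite (gap_sum (fun k => 1331/1000 * coupling N j k)) by apply (proj1 HE).
    rewrite <- coupling_sum, <- rsum_scal by auto.
    apply rsum_le. intros k Hk. pose proof (epoch_lastTime N M k Hk HE).
    pose proof (coupling_nonneg N j k Hj Hk). nra.
Qed.

(* Amortisation: the second-order error that an update causes in the signal of good [l] is stored in [pending]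
   until the next update of [l] pays for it.  The factor [21/40] is half of the [21/20] of
   [demand_step_other], the other half being paid by that next update at once. *)
Definition charge (r l : nat) : R :=
  21/40 * lambda * lambda * price r l * gap r * (clipped r * clipped r) * coupling r l (updated r).

Fixpoint pending (N l : nat) : R :=
  match N with
  | O => 0
  | S N' => if Nat.eqb l (updated N') then 0 else pending N' l + charge N' l
  end.

Lemma charge_nonneg r l : (l < n)%nat -> 0 <= charge r l.
Proof.
  intros Hl. unfold charge. pose proof (price_pos r l Hl). pose proof (gap_range r).
  pose proof (coupling_nonneg r l (updated r) Hl (updated_lt r)).
  repeat (first [apply Rle_0_sqr | apply Rmult_le_pos]); lra.
Qed.

Lemma pending_nonneg N l : (l < n)%nat -> 0 <= pending N l.
Proof.
  intros Hl. induction N as [|N IH]; simpl; [lra|].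
  destruct (Nat.eqb l (updated N)); [lra|]. pose proof (charge_nonneg N l Hl). lra.
Qed.

Lemma pending_epoch l M N : (l < n)%nat -> sameEpoch l M N ->
  rsum N (fun r => charge r l) - rsum M (fun r => charge r l) <= pending N l.
Proof.
  intros Hl HE. pose proof (proj1 HE) as HMN.
  assert (Hne : forall r, (M <= r < N)%nat -> l <> updated r)
    by (intros r Hr; now apply (sameEpoch_not_updated l M N)).
  clear HE. induction HMN as [|N HMN IH].
  - rewrite Rminus_diag. now apply pending_nonneg.
  - simpl. assert (E := Hne N ltac:(lia)). apply Nat.eqb_neq in E. rewrite E.
    assert (H2 := IH ltac:(intros; apply Hne; lia)). lra.
Qed.

Lemma charge_sum N :
  rsum n (fun l => charge N l) =
  21/40 * lambda * lambda * gap N * (clipped N * clipped N) *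
    (price N (updated N) * totalDemand (price N) (updated N)).
Proof.
  rewrite <- coupling_spending, <- rsum_scal by apply updated_lt.
  apply rsum_ext. intros l Hl. unfold charge. ring.
Qed.

Lemma pending_step N :
  rsum n (pending (S N)) <= rsum n (pending N) - pending N (updated N) + rsum n (fun l => charge N l).
Proof.
  pose proof (updated_lt N) as Hj.
  rewrite (rsum_update n (fun l => pending N l + charge N l) (pending (S N)) (updated N) Hj).
  - rewrite rsum_plus. simpl. rewrite Nat.eqb_refl.
    pose proof (charge_nonneg N (updated N) Hj). change (fun l => charge N l) with (charge N). lra.
  - intros l Hl E. simpl. apply Nat.eqb_neq in E. now rewrite E.
Qed.

(** The demand difference consists of the own update, with constant 11/5, and the path through the
    epoch. Half of the path is covered by [pending]; the other half costs
    [21/40 * 2662/1000 < 14/10], where 2662/1000 is twice the factor of [epoch_coupling]. Together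
    this gives 36/10. *)
Lemma epoch_error N M : sameEpoch (updated N) M N ->
  lambda * price N (updated N) * gap N *
    (Rabs (clipped N) * Rabs (totalDemand (price (S N)) (updated N) - totalDemand (price M) (updated N)))
  <= pending N (updated N) +
     lambda * price N (updated N) * gap N * (clipped N * clipped N) *
       (lambda * (36/10) * totalDemand (price N) (updated N)).
Proof.
  intros HE. pose proof (updated_lt N) as Hj. set (j := updated N) in *.
  pose proof (demand_step_own N) as Hown. fold j in Hown.
  pose proof (demand_path j M N Hj HE) as Hpath.
  pose proof (epoch_coupling_sum N M HE) as Hcs. fold j in Hcs.
  pose proof (pending_epoch j M N Hj HE) as Hpend.
  pose proof (gap_range N) as Hg. pose proof (price_pos N j Hj) as Hpp.
  pose proof (totalDemand_nonneg (price N) j Hj) as HX.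
  pose proof (pending_nonneg N j Hj) as Hpn.
  set (X := totalDemand (price N) j) in *.
  set (D := Rabs (clipped N)) in *.
  assert (HD : 0 <= D) by apply Rabs_pos.
  assert (HDD : clipped N * clipped N = D * D).
  { unfold D. rewrite <- Rabs_mult, Rabs_pos_eq; [reflexivity|apply Rle_0_sqr]. }
  rewrite HDD.
  set (SC := rsum N (fun r => charge r j) - rsum M (fun r => charge r j)) in *.
  set (SG := rsum N (fun r => gap r * coupling r j (updated r)) -
             rsum M (fun r => gap r * coupling r j (updated r))) in *.
  (* AM-GM on each pair of updates: [2 |d_N| |d_r| <= d_N^2 + d_r^2] *)
  assert (Hpair : lambda * price N j *
     (D * (rsum N (fun r => 21/20 * Rabs (relChange r) * coupling r j (updated r)) -
           rsum M (fun r => 21/20 * Rabs (relChange r) * coupling r j (updated r)))) <=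
     SC + 21/40 * lambda * lambda * price N j * (D * D) * SG).
  { unfold SC, SG. rewrite !Rmult_minus_distr_l, <- !rsum_scal.
    match goal with |- _ <= (?a - ?b) + (?u - ?v) => replace ((a - b) + (u - v)) with ((a + u) - (b + v)) by ring end.
    rewrite <- !rsum_plus. apply rsum_range_le; [apply HE|].
    intros r Hr. unfold charge. rewrite relChange_abs.
    rewrite (sameEpoch_price j r N) by (apply (sameEpoch_sub j M N r HE); lia).
    pose proof (coupling_nonneg r j (updated r) Hj (updated_lt r)) as Hcp.
    pose proof (gap_range r) as Hgr.
    assert (Hrr : clipped r * clipped r = Rabs (clipped r) * Rabs (clipped r)).
    { rewrite <- Rabs_mult, Rabs_pos_eq; [reflexivity|apply Rle_0_sqr]. }
    rewrite Hrr. set (dr := Rabs (clipped r)) in *.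
    assert (Hk : 0 <= lambda * lambda * price N j * gap r * coupling r j (updated r)).
    { repeat apply Rmult_le_pos; lra. }
    set (k := lambda * lambda * price N j * gap r * coupling r j (updated r)) in *.
    replace (lambda * price N j * (D * (21 / 20 * (lambda * dr * gap r) * coupling r j (updated r))))
      with (21/20 * (D * dr) * k) by (unfold k; ring).
    match goal with |- _ <= ?rhs => replace rhs with (21/40 * (dr * dr + D * D) * k) by (unfold k; ring) end.
    apply Rmult_le_compat_r; [auto|]. pose proof (Rle_0_sqr (D - dr)) as Hsq. unfold Rsqr in Hsq. lra. }
  set (PATH := rsum N (fun r => 21/20 * Rabs (relChange r) * coupling r j (updated r)) -
           rsum M (fun r => 21/20 * Rabs (relChange r) * coupling r j (updated r))) in *.
  assert (Htri : Rabs (totalDemand (price (S N)) j - totalDemand (price M) j) <=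
                 11/5 * (lambda * D) * X + PATH).
  { replace (totalDemand (price (S N)) j - totalDemand (price M) j) with
      ((totalDemand (price (S N)) j - X) + (X - totalDemand (price M) j)) by ring.
    eapply Rle_trans; [apply Rabs_triang|]. apply Rplus_le_compat; [|exact Hpath].
    eapply Rle_trans; [exact Hown|]. rewrite relChange_abs. fold D.
    apply Rmult_le_compat_r; [auto|].
    assert (lambda * D * gap N <= lambda * D * 1) by (apply Rmult_le_compat_l; [apply Rmult_le_pos|]; lra). lra. }
  assert (Hlp : 0 < lambda * price N j) by (apply Rmult_lt_0_compat; lra).
  assert (Hlpg : 0 < lambda * price N j * gap N) by (apply Rmult_lt_0_compat; lra).
  apply Rle_trans with (lambda * price N j * gap N * (D * (11/5 * (lambda * D) * X + PATH))).
  { apply Rmult_le_compat_l; [lra|]. apply Rmult_le_compat_l; lra. }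
  assert (HSG : 21/40 * lambda * lambda * price N j * (D * D) * SG <=
                21/40 * lambda * lambda * price N j * (D * D) * (2662/1000 * X)).
  { apply Rmult_le_compat_l; [|lra]. repeat apply Rmult_le_pos; lra. }
  assert (H5 : lambda * price N j * (D * PATH) <=
     pending N j + lambda * price N j * (D * D) * (lambda * (14/10) * X)).
  { assert (0 <= lambda * lambda * price N j * (D * D) * X) by (repeat apply Rmult_le_pos; lra). lra. }
  apply (Rmult_le_compat_l (gap N)) in H5; [|lra].
  (* The left side of the goal carries the current gap, which the stored charges do not contain; a
     gap is at most 1. *)
  assert (H6 : gap N * pending N j <= pending N j) by nra.
  assert (0 <= gap N * lambda * lambda * price N j * (D * D) * X) by (repeat apply Rmult_le_pos; lra).
  lra.
Qed.

Definition dissipation (N : nat) : R := price N (updated N) * gap N * (clipped N * clipped N).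

(** The total cost constant is [36/10 + 21/40 = 4125/1000]: the error in the signal plus the charges
    newly stored for the other goods. *)
Lemma descent N :
  phi (price (S N)) + rsum n (pending (S N)) <=
  phi (price N) + rsum n (pending N) - lambda / 2 * dissipation N.
Proof.
  pose proof (phi_step N) as H1. pose proof (pending_step N) as H2.
  rewrite charge_sum in H2.
  destruct (signal_bounds N) as (M1 & M2 & HM1 & HM2 & Hz1 & Hz2).
  pose proof (epoch_error N M1 HM1) as E1. pose proof (epoch_error N M2 HM2) as E2.
  pose proof (epoch_demand N M1 HM1) as HX1.
  pose proof (updated_lt N) as Hj. unfold dissipation. set (j := updated N) in *.
  pose proof (gap_range N) as Hg. pose proof (price_pos N j Hj) as Hpp.
  pose proof (totalDemand_nonneg (price N) j Hj) as HX.
  unfold relChange in H1.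
  pose proof (signal_ge N) as Hs.
  set (X := totalDemand (price N) j) in *.
  set (X' := totalDemand (price (S N)) j) in *.
  set (X1 := totalDemand (price M1) j) in *. set (X2 := totalDemand (price M2) j) in *.
  set (d := clipped N) in *. set (z := signal N) in *.
  assert (Hlp : 0 < lambda * price N j * gap N)
    by (apply Rmult_lt_0_compat; [apply Rmult_lt_0_compat|]; lra).
  set (k := lambda * price N j * gap N) in *.
  assert (Hkey : k * (z * d) - (pending N j + k * (d * d) * (lambda * (36/10) * X)) <= k * ((X' - 1) * d)).
  (* The sign of [d] selects the unfavourable end of the signal bounds: the upper one for a price
     increase, the lower one for a decrease. *)
  { destruct (Rle_lt_dec 0 d) as [Hd|Hd].
    - rewrite (Rabs_pos_eq d) in E2 by auto.
      assert (k * ((z - (X' - 1)) * d) <= k * (d * Rabs (X' - X2))); [|lra].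
      apply Rmult_le_compat_l; [lra|]. rewrite Rmult_comm. apply Rmult_le_compat_l; [auto|].
      pose proof (Rle_abs (- (X' - X2))) as Ha. rewrite Rabs_Ropp in Ha. lra.
    - rewrite (Rabs_left d) in E1 by auto.
      assert (k * ((z - (X' - 1)) * d) <= k * (- d * Rabs (X' - X1))); [|lra].
      apply Rmult_le_compat_l; [lra|].
      pose proof (Rle_abs (X' - X1)) as Ha. nra. }
  assert (Hgain : k * (d * d * (lambda * (4125/1000) * X)) <= k * (z * d - d * d / 2)).
  { apply Rmult_le_compat_l; [lra|].
    (* The lower signal bound gives [X <= 11/10 * (1 + z)], and
       [100/2346 * 11/10 * 4125/1000 < 2/10]. *)
    assert (HlX : lambda * (4125/1000) * X <= 2/10 * (1 + z)).
    { assert (lambda * X <= 100/2346 * (11/10 * (1 + z))) by (apply Rmult_le_compat; lra). lra. }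
    assert (0 <= d * d) by apply Rle_0_sqr.
    apply Rle_trans with (d * d * (2/10 * (1 + z))); [apply Rmult_le_compat_l; lra|].
    unfold d, clipped, Rmin. fold z. destruct (Rle_dec z 1); nra. }
  unfold k in Hkey, Hgain. unfold k in *.
  replace (- (X' - 1) * (price N j * (lambda * d * gap N)))
    with (- (lambda * price N j * gap N * ((X' - 1) * d))) in H1 by ring.
  lra.
Qed.

Lemma phi_lower : exists C, forall N, C <= phi (price N).
Proof.
  destruct price_bounded as [B [HB HpB]].
  destruct (rsum_bounded m (fun N i => - potential n (w i) (c i) (e i) (price N))) as [C HC].
  - intros i Hi. destruct (potential_lower n (w i) (c i) (e i) (Hc i Hi) (Hw i Hi) (Hwpos i Hi) (He i Hi) B HB) as [C HC].
    exists (- C). intros N. apply Ropp_le_contravar, HC. intros j Hj.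
    split; [now apply price_pos|now apply HpB].
  - exists (- C). intros N. specialize (HC N). unfold phi.
    assert (0 <= rsum n (price N)) by (apply rsum_nonneg; intros l Hl; left; now apply price_pos).
    rewrite (rsum_ext m _ (fun i => (-1) * potential n (w i) (c i) (e i) (price N))) in HC by (intros; ring).
    rewrite rsum_scal in HC. lra.
Qed.

Lemma dissipation_nonneg N : 0 <= dissipation N.
Proof.
  unfold dissipation. pose proof (price_pos N _ (updated_lt N)). pose proof (gap_range N).
  apply Rmult_le_pos; [apply Rmult_le_pos; lra|apply Rle_0_sqr].
Qed.

Lemma descent_sum N :
  phi (price N) + rsum n (pending N) + lambda / 2 * rsum N dissipation <= phi (price 0).
Proof.
  induction N as [|N IH].
  - assert (E : rsum n (pending 0) = 0) by apply (rsum_zero n).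
    rewrite E. change (rsum 0 dissipation) with 0. lra.
  - pose proof (descent N).
    change (rsum (S N) dissipation) with (rsum N dissipation + dissipation N). lra.
Qed.

Lemma phi_upper N : phi (price N) <= phi (price 0).
Proof.
  pose proof (descent_sum N).
  assert (0 <= rsum n (pending N)) by (apply rsum_nonneg; intros; now apply pending_nonneg).
  assert (0 <= rsum N dissipation) by (apply rsum_nonneg; intros; apply dissipation_nonneg).
  nra.
Qed.

Lemma dissipation_tail eps : 0 < eps -> exists N0, forall M N, (N0 <= M <= N)%nat ->
  rsum N dissipation - rsum M dissipation <= eps.
Proof.
  intros Heps. destruct phi_lower as [C HC].
  assert (Hgrow : Un_growing (fun N => rsum N dissipation)).
  { intros N. simpl. pose proof (dissipation_nonneg N). lra. }
  assert (Hub : has_ub (fun N => rsum N dissipation)).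
  { exists (2 / lambda * (phi (price 0) - C)). intros x [N ->].
    pose proof (descent_sum N). specialize (HC N).
    assert (0 <= rsum n (pending N)) by (apply rsum_nonneg; intros; now apply pending_nonneg).
    apply Rmult_le_reg_l with (lambda / 2); [lra|].
    replace (lambda / 2 * (2 / lambda * (phi (price 0) - C))) with (phi (price 0) - C) by (field; lra).
    lra. }
  destruct (CV_Cauchy _ (growing_cv _ Hgrow Hub) eps Heps) as [N0 H].
  exists N0. intros M N HMN. specialize (H N M ltac:(lia) ltac:(lia)).
  unfold Rdist in H. pose proof (Rle_abs (rsum N dissipation - rsum M dissipation)). lra.
Qed.

(** * Slow variation and limit points *)

Lemma eventTime_S_le N : eventTime (S N) <= eventTime N + 1.
Proof.
  pose proof (lastTime_ge (S N) _ (updated_lt (S N))).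
  pose proof (lastTime_S_le N _ (updated_lt (S N))). lra.
Qed.

Lemma first_event_after N s : 0 < s -> exists N', (N <= N')%nat /\
  eventTime N + s <= eventTime N' <= eventTime N + s + 1.
Proof.
  intros Hs. destruct (least_index (fun M => eventTime N + s <= eventTime M)) as [M [HM Hmin]].
  { destruct (eventTime_unbounded (eventTime N + s)) as [M HM]. exists M. lra. }
  assert (HNM : (N < M)%nat).
  { apply Nat.nle_gt. intros Hle. pose proof (eventTime_mono M N Hle). lra. }
  exists M. split; [lia|]. split; [auto|]. destruct M as [|M]; [lia|].
  specialize (Hmin M ltac:(lia)). apply Rnot_le_lt in Hmin. pose proof (eventTime_S_le M). lra.
Qed.

Lemma dissipation_range_nonneg M N : (M <= N)%nat -> 0 <= rsum N dissipation - rsum M dissipation.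
Proof.
  intros H. replace 0 with (rsum N (fun _ => 0) - rsum M (fun _ => 0)) by (rewrite !rsum_zero; ring).
  apply rsum_range_le; auto. intros; apply dissipation_nonneg.
Qed.

Lemma window_dissipation j b h M N : (M <= N)%nat -> 0 <= b -> 0 <= h ->
  (forall r, (M <= r < N)%nat -> updated r = j -> b <= price r j /\ h <= Rabs (clipped r)) ->
  b * (h * h) * (lastTime N j - lastTime M j) <= rsum N dissipation - rsum M dissipation.
Proof.
  intros HMN Hb Hh. induction HMN as [|N HMN IH]; intros H; [lra|].
  change (rsum (S N) dissipation) with (rsum N dissipation + dissipation N).
  assert (H1 := IH ltac:(intros r Hr; apply H; lia)). rewrite lastTime_S.
  pose proof (dissipation_nonneg N) as H2.
  destruct (Nat.eqb_spec j (updated N)) as [E|E]; [|rewrite Rplus_0_r; lra].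
  destruct (H N ltac:(lia) (eq_sym E)) as [H3 H4].
  assert (H5 : b * (h * h) * gap N <= dissipation N).
  { unfold dissipation. rewrite <- E. pose proof (gap_range N).
    replace (clipped N * clipped N) with (Rabs (clipped N) * Rabs (clipped N)).
    2:{ rewrite <- Rabs_mult, Rabs_pos_eq; [reflexivity|apply Rle_0_sqr]. }
    replace (b * (h * h) * gap N) with (b * gap N * (h * h)) by ring.
    apply Rmult_le_compat; [apply Rmult_le_pos; lra|apply Rle_0_sqr| |].
    - apply Rmult_le_compat_r; lra.
    - apply Rmult_le_compat; lra. }
  lra.
Qed.

(** Summable squares do not bound the length of the path. The split [d <= th + d^2 / th] bounds the
    movement by a small multiple of the elapsed time plus a multiple of the dissipation. *)
Lemma price_move l B th M N : (l < n)%nat -> (M <= N)%nat -> 0 < th ->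
  (forall r, price r l <= B) ->
  Rabs (price N l - price M l) <=
  lambda * B * th * (lastTime N l - lastTime M l) +
  lambda / th * (rsum N dissipation - rsum M dissipation).
Proof.
  intros Hl HMN Hth HB. induction HMN as [|N HMN IH].
  - rewrite !Rminus_diag, Rabs_R0. lra.
  - change (rsum (S N) dissipation) with (rsum N dissipation + dissipation N).
    rewrite lastTime_S. pose proof (dissipation_nonneg N) as Hd.
    assert (Hlt : 0 < lambda / th) by (apply Rdiv_lt_0_compat; lra).
    destruct (price_changed N) as [H1 H2].
    destruct (Nat.eqb_spec l (updated N)) as [E|E].
    2:{ rewrite H2 by auto. assert (0 <= lambda / th * dissipation N) by (apply Rmult_le_pos; lra). lra. }
    replace (price (S N) l - price M l) with
      ((price (S N) l - price N l) + (price N l - price M l)) by ring.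
    eapply Rle_trans; [apply Rabs_triang|].
    assert (Hstep : Rabs (price (S N) l - price N l) <=
                    lambda * B * th * gap N + lambda / th * dissipation N).
    { unfold dissipation. rewrite E, H1, <- E.
      replace (price N l * (1 + relChange N) - price N l) with (price N l * relChange N) by ring.
      pose proof (price_pos N l Hl) as Hp. pose proof (gap_range N) as Hg.
      rewrite Rabs_mult, (Rabs_pos_eq (price N l)), relChange_abs by lra.
      replace (clipped N * clipped N) with (Rabs (clipped N) * Rabs (clipped N)).
      2:{ rewrite <- Rabs_mult, Rabs_pos_eq; [reflexivity|apply Rle_0_sqr]. }
      set (d := Rabs (clipped N)).
      assert (HB' : lambda * th * gap N * price N l <= lambda * th * gap N * B).
      { apply Rmult_le_compat_l; auto. repeat apply Rmult_le_pos; lra. }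
      assert (Hq : d <= th + d * d / th).
      { apply Rmult_le_reg_r with th; auto.
        replace ((th + d * d / th) * th) with (th * th + d * d) by (field; lra). nra. }
      assert (Hk : 0 <= lambda * price N l * gap N) by (repeat apply Rmult_le_pos; lra).
      apply (Rmult_le_compat_l _ _ _ Hk) in Hq.
      replace (lambda / th * (price N l * gap N * (d * d))) with
        (lambda * price N l * gap N * (d * d / th)) by (field; lra).
      lra. }
    lra.
Qed.

Lemma drift_small eps L : 0 < eps -> 0 <= L ->
  exists N0, forall M N, (N0 <= M <= N)%nat -> eventTime N - eventTime M <= L ->
    forall l, (l < n)%nat -> Rabs (price N l - price M l) <= eps.
Proof.
  intros Heps HL. destruct price_bounded as [B [HB HpB]].
  assert (HlB : 0 < lambda * B) by (apply Rmult_lt_0_compat; lra).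
  (* Makes the time part [eps / 2]; the tail of the dissipation is then chosen to give the other
     half. [L + 1] appears because a gap may begin one unit before event [M]. *)
  set (th := eps / (2 * (lambda * B) * (L + 1))).
  assert (Hth : 0 < th).
  { apply Rdiv_lt_0_compat; auto. repeat apply Rmult_lt_0_compat; lra. }
  destruct (dissipation_tail (eps * th / (2 * lambda))) as [N0 HN0].
  { apply Rdiv_lt_0_compat; [apply Rmult_lt_0_compat; auto|lra]. }
  exists N0. intros M N HMN HT l Hl.
  pose proof (price_move l B th M N Hl (proj2 HMN) Hth (fun r => HpB r l Hl)) as H1.
  specialize (HN0 M N HMN).
  pose proof (lastTime_lt N l Hl). pose proof (lastTime_ge M l Hl).
  assert (H2 : lambda * B * th * (lastTime N l - lastTime M l) <= lambda * B * th * (L + 1)).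
  { apply Rmult_le_compat_l; [apply Rmult_le_pos|]; lra. }
  assert (H3 : lambda * B * th * (L + 1) = eps / 2) by (unfold th; field; split; lra).
  assert (H4 : lambda / th * (rsum N dissipation - rsum M dissipation) <=
               lambda / th * (eps * th / (2 * lambda))).
  { apply Rmult_le_compat_l; auto. left. apply Rdiv_lt_0_compat; lra. }
  replace (lambda / th * (eps * th / (2 * lambda))) with (eps / 2) in H4 by (field; lra). lra.
Qed.

(** A signal is at most one time unit old, so one unit after event [N] only events from [N] on can
    enter it. *)
Lemma late_epoch N r M : sameEpoch (updated r) M r -> eventTime N + 1 <= eventTime r -> (N <= M)%nat.
Proof.
  intros [HMr HE] Ht. apply Nat.nlt_ge. intros Hlt.
  pose proof (lastTime_ge r _ (updated_lt r)).
  pose proof (lastTime_lt M _ (updated_lt r)) as H1.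
  assert (E : lastTime M (updated r) = lastTime r (updated r)) by (unfold lastTime; now rewrite HE).
  pose proof (eventTime_mono M N ltac:(lia)). lra.
Qed.

Lemma clipped_of_excess N r h : eventTime N + 1 <= eventTime r -> 0 <= h <= 1 ->
  (forall M, (N <= M <= r)%nat -> 1 + h <= totalDemand (price M) (updated r)) -> h <= clipped r.
Proof.
  intros Ht Hh H. destruct (signal_bounds r) as (M1 & _ & HE & _ & Hz & _).
  assert (1 + h <= totalDemand (price M1) (updated r)).
  { apply H. split; [now apply late_epoch with r|apply HE]. }
  apply Rmin_glb; lra.
Qed.

Lemma clipped_of_shortage N r h : eventTime N + 1 <= eventTime r ->
  (forall M, (N <= M <= r)%nat -> totalDemand (price M) (updated r) <= 1 - h) -> clipped r <= - h.
Proof.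
  intros Ht H. destruct (signal_bounds r) as (_ & M2 & _ & HE & _ & Hz).
  assert (totalDemand (price M2) (updated r) <= 1 - h).
  { apply H. split; [now apply late_epoch with r|apply HE]. }
  unfold clipped. eapply Rle_trans; [apply Rmin_l|lra].
Qed.

(** Of the four time units, one flushes outdated signals and up to one more passes until the next
    event; the rest contains gaps of good [j] of total length at least 1. *)
Lemma persistent_imbalance j b h N N' : (j < n)%nat -> (N <= N')%nat ->
  eventTime N + 4 <= eventTime N' -> 0 <= b -> 0 <= h <= 1 ->
  (forall r, (N <= r <= N')%nat -> b <= price r j) ->
  (forall r, (N <= r <= N')%nat -> 1 + h <= totalDemand (price r) j) \/
  (forall r, (N <= r <= N')%nat -> totalDemand (price r) j <= 1 - h) ->
  b * (h * h) <= rsum N' dissipation - rsum N dissipation.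
Proof.
  intros Hj HNN' Ht Hb Hh Hp Hcase.
  destruct (first_event_after N 1 ltac:(lra)) as (M & HNM & HM1 & HM2).
  assert (HMN' : (M <= N')%nat).
  { apply Nat.nlt_ge. intros Hlt. pose proof (eventTime_mono N' M ltac:(lia)). lra. }
  assert (H1 : b * (h * h) * (lastTime N' j - lastTime M j) <= rsum N' dissipation - rsum M dissipation).
  { apply window_dissipation; auto; [lra|]. intros r Hr E. split; [apply Hp; lia|].
    pose proof (eventTime_mono M r ltac:(lia)).
    destruct Hcase as [Hc1|Hc1].
    - eapply Rle_trans; [|apply Rle_abs]. apply (clipped_of_excess N r h); auto; [lra|].
      intros M' HM'. rewrite E. apply Hc1. lia.
    - rewrite <- Rabs_Ropp. eapply Rle_trans; [|apply Rle_abs].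
      apply Ropp_le_cancel. rewrite Ropp_involutive. apply (clipped_of_shortage N r h); [lra|].
      intros M' HM'. rewrite E. apply Hc1. lia. }
  pose proof (lastTime_ge N' j Hj). pose proof (lastTime_lt M j Hj).
  pose proof (dissipation_range_nonneg N M HNM).
  assert (0 <= b * (h * h)) by (apply Rmult_le_pos; [auto|apply Rle_0_sqr]).
  assert (b * (h * h) * 1 <= b * (h * h) * (lastTime N' j - lastTime M j))
    by (apply Rmult_le_compat_l; lra).
  lra.
Qed.

(** * Limit points of the trajectory *)

Definition limitPoint (q : nat -> R) : Prop :=
  forall eps, 0 < eps -> infinitelyOften (fun N => closeTo n eps (price N) q).

Lemma limitPoint_nonneg q j : limitPoint q -> (j < n)%nat -> 0 <= q j.
Proof.
  intros Hq Hj. apply Rnot_lt_le. intros Hlt.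
  destruct (Hq (- q j) ltac:(lra) 0%nat) as (N & _ & HN). specialize (HN j Hj).
  pose proof (price_pos N j Hj). apply Rabs_def2 in HN. lra.
Qed.

(** An imbalance at [q] would persist over a stretch of time, because prices drift slowly, and
    dissipate a fixed amount arbitrarily late. The limit demand [v] is a parameter since at zero
    prices [totalDemand] need not be the continuous extension. *)
Lemma limitPoint_market_clears q j v :
  limitPoint q -> (j < n)%nat -> 0 < q j ->
  (forall eps, 0 < eps -> exists d, 0 < d /\
     forall N, closeTo n d (price N) q -> Rabs (totalDemand (price N) j - v) < eps) ->
  v = 1.
Proof.
  intros Hq Hj Hqj Hv. apply NNPP. intros Hne.
  assert (Hv1 : 0 < Rabs (v - 1)) by (apply Rabs_pos_lt; lra).
  set (h0 := Rabs (v - 1) / 2) in *. assert (Hh0 : 0 < h0) by (unfold h0; lra).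
  set (h := Rmin h0 1). assert (Hh : 0 < h) by (apply Rmin_pos; lra).
  assert (Hhh : h <= h0 /\ h <= 1) by (split; [apply Rmin_l|apply Rmin_r]).
  destruct (Hv h0 Hh0) as [d [Hd HX]].
  set (d' := Rmin d (q j / 2)). assert (Hd' : 0 < d') by (apply Rmin_pos; lra).
  assert (Hdd : d' <= d /\ d' <= q j / 2) by (split; [apply Rmin_l|apply Rmin_r]).
  (* Five is the longest possible window: four units and up to one more until the next event. *)
  destruct (drift_small (d' / 2) 5 ltac:(lra) ltac:(lra)) as [N0 HN0].
  assert (Hqh : 0 < q j / 2 * (h * h)) by (repeat apply Rmult_lt_0_compat; lra).
  destruct (dissipation_tail (q j / 2 * (h * h) / 2) ltac:(lra)) as [N1 HN1].
  destruct (Hq (d' / 2) ltac:(lra) (Nat.max N0 N1)) as (N & HN & Hclose).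
  destruct (first_event_after N 4 ltac:(lra)) as (N' & HNN' & Ht1 & Ht2).
  specialize (HN1 N N' ltac:(lia)).
  assert (Hall : forall r, (N <= r <= N')%nat -> closeTo n d' (price r) q).
  { intros r Hr l Hl. pose proof (eventTime_mono r N' ltac:(lia)).
    pose proof (HN0 N r ltac:(lia) ltac:(lra) l Hl) as H1. specialize (Hclose l Hl).
    replace (price r l - q l) with ((price r l - price N l) + (price N l - q l)) by ring.
    eapply Rle_lt_trans; [apply Rabs_triang|lra]. }
  assert (H : q j / 2 * (h * h) <= rsum N' dissipation - rsum N dissipation); [|lra].
  apply (persistent_imbalance j); auto; try lra.
  - intros r Hr. specialize (Hall r Hr j Hj). apply Rabs_def2 in Hall. lra.
  - assert (HXr : forall r, (N <= r <= N')%nat -> Rabs (totalDemand (price r) j - v) < h0).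
    { intros r Hr. apply HX. apply closeTo_weaken with d'; [lra|auto]. }
    destruct (Rle_lt_dec 1 v) as [Hv2|Hv2].
    + left. intros r Hr. specialize (HXr r Hr). apply Rabs_def2 in HXr.
      unfold h0 in *. rewrite Rabs_pos_eq in * by lra. lra.
    + right. intros r Hr. specialize (HXr r Hr). apply Rabs_def2 in HXr.
      unfold h0 in *. rewrite Rabs_left in * by lra. lra.
Qed.

(** Also covers goods whose price might vanish in the limit: permanent excess makes the price
    nondecreasing from some event on, hence bounded below, and the dissipation could not be
    summable. *)
Lemma no_persistent_excess j a N0 : (j < n)%nat -> 0 < a ->
  ~ (forall N, (N0 <= N)%nat -> 1 + a <= totalDemand (price N) j).
Proof.
  intros Hj Ha H. set (h := Rmin a 1). assert (Hh : 0 < h) by (apply Rmin_pos; lra).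
  assert (Hhh : h <= a /\ h <= 1) by (split; [apply Rmin_l|apply Rmin_r]).
  destruct (first_event_after N0 1 ltac:(lra)) as (M & HM & Ht & _).
  assert (Hmono : forall N, (M <= N)%nat -> price M j <= price N j).
  { induction 1 as [|N HMN IH]; [lra|]. destruct (price_changed N) as [H1 H2].
    destruct (Nat.eq_dec j (updated N)) as [E|E]; [|now rewrite H2].
    assert (h <= clipped N).
    { pose proof (eventTime_mono M N HMN). apply (clipped_of_excess N0); [lra|lra|].
      intros r Hr. rewrite <- E. specialize (H r ltac:(lia)). lra. }
    rewrite E, H1, <- E. pose proof (price_pos N j Hj).
    assert (0 <= relChange N).
    { unfold relChange. pose proof (gap_range N). repeat apply Rmult_le_pos; lra. }
    nra. }
  pose proof (price_pos M j Hj) as Hp.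
  assert (Hph : 0 < price M j * (h * h)) by (repeat apply Rmult_lt_0_compat; lra).
  destruct (dissipation_tail (price M j * (h * h) / 2) ltac:(lra)) as [N1 HN1].
  set (N := Nat.max M N1).
  destruct (first_event_after N 4 ltac:(lra)) as (N' & HNN' & Ht' & _).
  specialize (HN1 N N' ltac:(lia)).
  assert (Hfin : price M j * (h * h) <= rsum N' dissipation - rsum N dissipation); [|lra].
  apply (persistent_imbalance j); auto; try lra.
  - intros r Hr. apply Hmono. lia.
  - left. intros r Hr. specialize (H r ltac:(lia)). lra.
Qed.

Lemma limitPoint_exists Q : infinitelyOften Q ->
  exists q, forall eps, 0 < eps -> infinitelyOften (fun N => Q N /\ closeTo n eps (price N) q).
Proof.
  intros HQ. destruct price_bounded as [B [HB HpB]].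
  apply (cluster_point n price B Q); auto.
  intros N l Hl. pose proof (price_pos N l Hl). specialize (HpB N l Hl). lra.
Qed.

(** * Convergence for complementary-CES utilities *)

Section PositiveElasticity.
Hypothesis Hcpos : forall i, (i < m)%nat -> 0 < c i.

(** Below [eps] the power [p^(-c)] makes this single buyer's demand at least 2, as the index is
    bounded above by boundedness of prices. The own price is fixed during the epoch, so the clipped
    signal is 1 and the price does not fall; from above [eps], one update cannot halve it. *)
Lemma wanted_price_lower i j : (i < m)%nat -> (j < n)%nat -> 0 < w i j ->
  exists b, 0 < b /\ forall N, b <= price N j.
Proof.
  intros Hi Hj Hwij. destruct price_bounded as [B [HB HpB]].
  pose proof (Hc i Hi) as Hci. pose proof (Hcpos i Hi) as Hci0. pose proof (He i Hi) as Hei.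
  pose proof (priceIndex_pos n (w i) (c i) (Hw i Hi) (Hwpos i Hi) (fun _ => B)) as HSB.
  set (SB := priceIndex n (w i) (c i) (fun _ => B)) in *.
  (* Solves [e w K / SB = 2]; then [eps = K^(-1/c)]. *)
  set (K := 2 * SB / (e i * w i j)).
  assert (Hew : 0 < e i * w i j) by (now apply Rmult_lt_0_compat).
  assert (HK : 0 < K) by (apply Rdiv_lt_0_compat; lra).
  set (eps := exp (- ln K / c i)).
  assert (Heps : 0 < eps) by apply exp_pos.
  assert (Hbig : forall N, price N j <= eps -> 2 <= totalDemand (price N) j).
  { intros N HN. pose proof (price_pos N j Hj) as Hp.
    apply Rle_trans with (demand n (w i) (c i) (e i) (price N) j).
    - pose proof (priceIndex_pos n (w i) (c i) (Hw i Hi) (Hwpos i Hi) (price N)) as HS.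
      assert (HSle : priceIndex n (w i) (c i) (price N) <= SB).
      { apply rsum_le. intros l Hl. apply Rmult_le_compat_l; [auto|].
        apply Rle_Rpower_l; [lra|]. split; [now apply price_pos|auto]. }
      assert (HKle : K <= Rpower (price N j) (- c i)).
      { unfold Rpower. rewrite <- (exp_ln K HK).
        assert (Hl : ln K <= - c i * ln (price N j)).
        { pose proof (ln_le _ _ Hp HN) as H1. unfold eps in H1. rewrite ln_exp in H1.
          apply (Rmult_le_compat_l (c i)) in H1; [|lra].
          replace (c i * (- ln K / c i)) with (- ln K) in H1 by (field; lra). lra. }
        destruct Hl as [Hl|Hl]; [left; now apply exp_increasing|rewrite Hl; lra]. }
      unfold demand. apply Rmult_le_reg_r with (priceIndex n (w i) (c i) (price N)); auto.
      set (S := priceIndex n (w i) (c i) (price N)) in *.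
      replace (e i * (w i j * Rpower (price N j) (- c i)) / S * S)
        with (e i * (w i j * Rpower (price N j) (- c i))) by (field; lra).
      apply Rle_trans with (2 * SB); [lra|].
      replace (2 * SB) with (e i * w i j * K) by (unfold K; field; lra).
      rewrite <- Rmult_assoc. apply Rmult_le_compat_l; lra.
    - apply (rsum_term_le m (fun i => demand n (w i) (c i) (e i) (price N) j)); auto.
      intros i' Hi'. apply demand_nonneg; auto. }
  exists (Rmin (price 0 j) (eps / 2)). split; [apply Rmin_pos; [now apply price_pos|lra]|].
  induction N as [|N IH]; [apply Rmin_l|].
  destruct (price_changed N) as [H1 H2].
  destruct (Nat.eq_dec j (updated N)) as [E|E]; [|now rewrite H2].
  rewrite E, H1, <- E. pose proof (price_pos N j Hj) as Hp. pose proof (relChange_range N).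
  destruct (Rle_lt_dec (price N j) eps) as [Hs|Hb].
  - destruct (signal_bounds N) as (M & _ & HM & _ & Hz & _). rewrite <- E in *.
    pose proof (sameEpoch_price _ _ _ HM) as EP.
    pose proof (Hbig M ltac:(lra)).
    assert (0 <= relChange N).
    { assert (Hcl : 1 <= clipped N) by (apply Rmin_glb; lra).
      unfold relChange. pose proof (gap_range N). repeat apply Rmult_le_pos; lra. }
    nra.
  - eapply Rle_trans; [apply Rmin_r|]. nra.
Qed.

Lemma limitPoint_wantedPos q i : limitPoint q -> (i < m)%nat -> wantedPos n (w i) q.
Proof.
  intros Hq Hi j Hj Hwij. destruct (wanted_price_lower i j Hi Hj Hwij) as [b [Hb Hbp]].
  destruct (Hq b Hb 0%nat) as (N & _ & HN). specialize (HN j Hj). specialize (Hbp N).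
  apply Rabs_def2 in HN. lra.
Qed.

Lemma limitPoint_clears_pos q j : limitPoint q -> (j < n)%nat -> 0 < q j -> totalDemand q j = 1.
Proof.
  intros Hq Hj Hqj. apply (limitPoint_market_clears q j); auto.
  intros eps Heps.
  destruct (tendsAt_rsum n m (fun i a => demand n (w i) (c i) (e i) a j) q
              (fun i => demand n (w i) (c i) (e i) q j)) with (eps := eps) as [d [Hd H]]; auto.
  - intros i Hi. apply tendsAt_demand; auto using limitPoint_wantedPos.
  - exists d. split; auto. intros N HN. now apply H.
Qed.

Lemma limitPoint_zero q j : limitPoint q -> (j < n)%nat -> q j = 0 -> totalDemand q j = 0.
Proof.
  intros Hq Hj E. unfold totalDemand. rewrite <- (rsum_zero m). apply rsum_ext. intros i Hi.
  apply demand_unwanted. destruct (Rle_lt_or_eq_dec 0 (w i j) (Hw i Hi j Hj)) as [H|H]; auto.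
  pose proof (limitPoint_wantedPos q i Hq Hi j Hj H). lra.
Qed.

(** If [q j > 0], clearing provides a buyer who wants [j], and then the price of [j] is positive at
    every limit point. *)
Lemma limitPoint_same_support q q' j : limitPoint q -> limitPoint q' -> (j < n)%nat ->
  q j * totalDemand q' j = q j.
Proof.
  intros Hq Hq' Hj.
  destruct (Rle_lt_or_eq_dec 0 (q j) (limitPoint_nonneg q j Hq Hj)) as [H|H]; [|rewrite <- H; ring].
  destruct (Rle_lt_or_eq_dec 0 (q' j) (limitPoint_nonneg q' j Hq' Hj)) as [H'|H'].
  { rewrite (limitPoint_clears_pos q') by auto. ring. }
  exfalso. pose proof (limitPoint_clears_pos q j Hq Hj H) as H1.
  pose proof (limitPoint_zero q' j Hq' Hj (eq_sym H')) as H2.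
  assert (Hz : totalDemand q j = 0); [|lra].
  unfold totalDemand. rewrite <- (rsum_zero m). apply rsum_ext. intros i Hi.
  apply demand_unwanted. destruct (Rle_lt_or_eq_dec 0 (w i j) (Hw i Hi j Hj)) as [Hwij|]; auto.
  pose proof (limitPoint_wantedPos q' i Hq' Hi j Hj Hwij). lra.
Qed.

Lemma cross_spending q q' : limitPoint q -> limitPoint q' ->
  rsum m (fun i => rsum n (fun j => q j * demand n (w i) (c i) (e i) q' j)) = rsum n q.
Proof.
  intros Hq Hq'. rewrite rsum_swap. apply rsum_ext. intros j Hj.
  rewrite rsum_scal. now apply limitPoint_same_support.
Qed.

Lemma limitPoint_total q : limitPoint q -> rsum n q = rsum m e.
Proof.
  intros Hq. rewrite <- (cross_spending q q Hq Hq). apply rsum_ext. intros i Hi.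
  apply demand_budget; auto using limitPoint_wantedPos.
Qed.

(** The gradient inequalities between [q] and [q'] are added in both directions: the potentials
    cancel and the cross spending adds up to the budgets, so all are tight. Strictness fixes the
    prices of wanted goods; a good wanted by nobody has limit price 0. *)
Lemma limitPoint_unique q q' : limitPoint q -> limitPoint q' ->
  forall j, (j < n)%nat -> q j = q' j.
Proof.
  intros Hq Hq'.
  set (F := fun q q' i => potential n (w i) (c i) (e i) q - potential n (w i) (c i) (e i) q' +
     (rsum n (fun j => q j * demand n (w i) (c i) (e i) q' j) - e i)).
  assert (HF : forall q q', limitPoint q -> limitPoint q' -> forall i, (i < m)%nat -> 0 <= F q q' i).
  { intros a b Ha Hb i Hi. apply potential_tangent_nonneg; auto using limitPoint_wantedPos. }
  assert (Hsum : rsum m (fun i => F q q' i + F q' q i) = 0).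
  { rewrite (rsum_ext m _ (fun i =>
      (rsum n (fun j => q j * demand n (w i) (c i) (e i) q' j) - e i) +
      (rsum n (fun j => q' j * demand n (w i) (c i) (e i) q j) - e i)))
      by (intros; unfold F; ring).
    rewrite rsum_plus, !rsum_minus, !cross_spending, !limitPoint_total by auto. ring. }
  intros j Hj.
  destruct (classic (exists i, (i < m)%nat /\ 0 < w i j)) as [[i [Hi Hwij]]|Hno].
  - assert (H0 : F q q' i + F q' q i = 0).
    { apply (rsum_nonneg_eq0 m (fun i => F q q' i + F q' q i)); auto; [|lra].
      intros k Hk. pose proof (HF q q' Hq Hq' k Hk). pose proof (HF q' q Hq' Hq k Hk). lra. }
    pose proof (HF q' q Hq' Hq i Hi).
    apply (potential_tangent_eq0 n (w i) (c i) (e i) (Hc i Hi) (Hw i Hi) (Hwpos i Hi) (He i Hi) q q');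
      auto using limitPoint_wantedPos. unfold F in *. lra.
  - assert (Hz : forall a, limitPoint a -> a j = 0).
    { intros a Ha. destruct (Rle_lt_or_eq_dec 0 (a j) (limitPoint_nonneg a j Ha Hj)) as [H|]; auto.
      pose proof (limitPoint_clears_pos a j Ha Hj H) as H1.
      assert (H2 : totalDemand a j = 0); [|lra].
      unfold totalDemand. rewrite <- (rsum_zero m). apply rsum_ext. intros i Hi.
      apply demand_unwanted. destruct (Rle_lt_or_eq_dec 0 (w i j) (Hw i Hi j Hj)) as [Hwij|]; auto.
      exfalso. eauto. }
    now rewrite !Hz.
Qed.

Theorem convergence_positive_elasticity :
  exists q, (forall j, (j < n)%nat -> 0 <= q j) /\
    (forall i, (i < m)%nat -> wantedPos n (w i) q) /\
    (forall j, (j < n)%nat -> (0 < q j -> totalDemand q j = 1) /\ (q j = 0 -> totalDemand q j = 0)) /\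
    (forall eps, 0 < eps -> exists T0, forall t, T0 <= t ->
       forall j, (j < n)%nat -> Rabs (p t j - q j) < eps).
Proof.
  destruct (limitPoint_exists (fun _ => True)) as [q Hq0].
  { intros N0. exists N0. auto. }
  assert (Hq : limitPoint q).
  { intros eps Heps N0. destruct (Hq0 eps Heps N0) as (N & H1 & _ & H2). eauto. }
  exists q. split; [intros; now apply limitPoint_nonneg|].
  split; [intros; now apply limitPoint_wantedPos|].
  split; [intros j Hj; split; intros; [now apply limitPoint_clears_pos|now apply limitPoint_zero]|].
  intros eps Heps.
  (* Infinitely many events away from [q] would have a cluster point, which uniqueness identifies
     with [q]. *)
  assert (Hev : exists N0, forall N, (N0 <= N)%nat -> closeTo n eps (price N) q).
  { apply NNPP. intros Hno.
    destruct (limitPoint_exists (fun N => ~ closeTo n eps (price N) q)) as [q' Hq'].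
    { intros N0. apply NNPP. intros H. apply Hno. exists N0. intros N HN.
      apply NNPP. intros Hc'. apply H. eauto. }
    assert (Hlq' : limitPoint q').
    { intros d Hd N0. destruct (Hq' d Hd N0) as (N & H1 & _ & H2). eauto. }
    destruct (Hq' eps Heps 0%nat) as (N & _ & H1 & H2). apply H1.
    intros l Hl. rewrite (limitPoint_unique q q' Hq Hlq' l Hl). now apply H2. }
  destruct Hev as [N0 HN0]. exists (eventTime N0 + 1). intros t Ht j Hj.
  pose proof (eventTime_pos N0).
  destruct (price_of_time t ltac:(lra)) as (M & HM & _ & Hp). rewrite (Hp j Hj).
  apply HN0; auto. apply Nat.nlt_ge. intros Hlt. pose proof (eventTime_mono M N0 ltac:(lia)). lra.
Qed.
End PositiveElasticity.

(** * Limit points for Leontief utilities *)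

Section ZeroElasticity.
Hypothesis Hc0 : forall i, (i < m)%nat -> c i = 0.

(** Agrees with [totalDemand] along the trajectory and stays continuous at zero prices as long as
    the bundle costs are positive. *)
Definition fixedDemand (q : nat -> R) (j : nat) : R :=
  rsum m (fun i => leontief_demand n (e i) (w i) q j).

Lemma totalDemand_fixed N j : (j < n)%nat -> totalDemand (price N) j = fixedDemand (price N) j.
Proof.
  intros Hj. apply rsum_ext. intros i Hi. rewrite Hc0 by auto. symmetry.
  apply leontief_demand_eq; auto. intros; now apply price_pos.
Qed.

(** [phi] never exceeds its initial value, prices are positive and the other potentials are bounded
    below; hence the potential of buyer [i] is bounded above. *)
Lemma bundleCost_lower i : (i < m)%nat ->
  exists s, 0 < s /\ forall N, s <= bundleCost n (w i) (price N).
Proof.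
  intros Hi. destruct price_bounded as [B [HB HpB]].
  destruct (finite_upper_bound m (fun N i => - potential n (w i) (c i) (e i) (price N))) as [C HC].
  { intros k Hk.
    destruct (potential_lower n (w k) (c k) (e k) (Hc k Hk) (Hw k Hk) (Hwpos k Hk) (He k Hk) B HB) as [C HC].
    exists (- C). intros N. apply Ropp_le_contravar, HC. intros j Hj.
    split; [now apply price_pos|now apply HpB]. }
  destruct (priceIndex_lower n (w i) (c i) (e i) (Hw i Hi) (Hwpos i Hi) (He i Hi)
              (phi (price 0) + rsum m (fun _ => C) - C)) as [s [Hs Hlow]]; [rewrite Hc0; auto; lra|].
  exists s. split; auto. intros N.
  replace (bundleCost n (w i) (price N)) with (priceIndex n (w i) (c i) (price N)).
  - apply Hlow. pose proof (phi_upper N) as H1. unfold phi at 1 in H1.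
    assert (H2 : 0 <= rsum n (price N)) by (apply rsum_nonneg; intros; left; now apply price_pos).
    pose proof (rsum_term_le m (fun i => potential n (w i) (c i) (e i) (price N) + C) i) as H3.
    cbv beta in H3. rewrite rsum_plus in H3.
    assert (H4 : forall k, (k < m)%nat -> 0 <= potential n (w k) (c k) (e k) (price N) + C).
    { intros k Hk. specialize (HC k Hk N). lra. }
    specialize (H3 H4 Hi). lra.
  - apply rsum_ext. intros j Hj. rewrite Hc0, Rminus_0_r, Rpower_1; auto using price_pos.
Qed.

Lemma limitPoint_bundleCost q i : limitPoint q -> (i < m)%nat -> 0 < bundleCost n (w i) q.
Proof.
  intros Hq Hi. destruct (bundleCost_lower i Hi) as [s [Hs Hlow]].
  destruct (tendsAt_bundleCost n (w i) q s Hs) as [d [Hd H]].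
  destruct (Hq d Hd 0%nat) as (N & _ & HN). specialize (H _ HN). specialize (Hlow N).
  apply Rabs_def2 in H. lra.
Qed.

Lemma tendsAt_fixedDemand q j : limitPoint q ->
  tendsAt n (fun a => fixedDemand a j) q (fixedDemand q j).
Proof.
  intros Hq. apply (tendsAt_rsum n m (fun i a => leontief_demand n (e i) (w i) a j)).
  intros i Hi. apply tendsAt_leontief. now apply limitPoint_bundleCost.
Qed.

Lemma limitPoint_clears_fixed q j : limitPoint q -> (j < n)%nat -> 0 < q j -> fixedDemand q j = 1.
Proof.
  intros Hq Hj Hqj. apply (limitPoint_market_clears q j); auto.
  intros eps Heps. destruct (tendsAt_fixedDemand q j Hq eps Heps) as [d [Hd H]].
  exists d. split; auto. intros N HN. rewrite totalDemand_fixed by auto. now apply H.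
Qed.

(** Equal supports ensure that each good priced at [q] clears at [q'], so the demands at [q'],
    valued at [q], cost the total of [q]. *)
Lemma cross_spending_fixed q q' : limitPoint q -> limitPoint q' ->
  (forall j, (j < n)%nat -> 0 < q j <-> 0 < q' j) ->
  rsum m (fun i => e i * (bundleCost n (w i) q / bundleCost n (w i) q')) = rsum n q.
Proof.
  intros Hq Hq' Hs.
  rewrite (rsum_ext m _ (fun i => rsum n (fun j => q j * leontief_demand n (e i) (w i) q' j))).
  - rewrite rsum_swap. apply rsum_ext. intros j Hj. rewrite rsum_scal.
    fold (fixedDemand q' j).
    destruct (Rle_lt_or_eq_dec 0 (q j) (limitPoint_nonneg q j Hq Hj)) as [H|H]; [|rewrite <- H; ring].
    rewrite limitPoint_clears_fixed; auto; [ring|now apply Hs].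
  - intros i Hi. unfold leontief_demand.
    rewrite (rsum_ext n _ (fun j => e i / bundleCost n (w i) q' * (w i j * q j)))
      by (intros; unfold Rdiv; ring).
    rewrite rsum_scal. fold (bundleCost n (w i) q). unfold Rdiv; ring.
Qed.

(* The bundle costs [l], [l'] of each buyer agree, since [l/l' + l'/l >= 2] with equality only for [l = l'],
   and the weighted sum over the buyers attains this bound. *)
Lemma limitPoint_support_demand q q' j : limitPoint q -> limitPoint q' ->
  (forall j, (j < n)%nat -> 0 < q j <-> 0 < q' j) -> fixedDemand q j = fixedDemand q' j.
Proof.
  intros Hq Hq' Hs.
  assert (Hs' : forall j, (j < n)%nat -> 0 < q' j <-> 0 < q j) by (intros; symmetry; auto).
  set (l := fun i => bundleCost n (w i) q). set (l' := fun i => bundleCost n (w i) q').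
  assert (Hself : forall a, limitPoint a -> rsum n a = rsum m e).
  { intros a Ha. rewrite <- (cross_spending_fixed a a) by (tauto || auto). apply rsum_ext.
    intros i Hi. pose proof (limitPoint_bundleCost a i Ha Hi). field; lra. }
  assert (Hsum : rsum m (fun i => e i * (l i / l' i + l' i / l i - 2)) = 0).
  { rewrite (rsum_ext m _ (fun i => (e i * (l i / l' i) + e i * (l' i / l i)) - 2 * e i)) by (intros; ring).
    rewrite rsum_minus, rsum_plus, rsum_scal. unfold l, l'.
    rewrite !cross_spending_fixed, !Hself by auto. ring. }
  assert (Hel : forall i, (i < m)%nat -> l i = l' i).
  { intros i Hi. pose proof (limitPoint_bundleCost q i Hq Hi) as H1. fold (l i) in H1.
    pose proof (limitPoint_bundleCost q' i Hq' Hi) as H2. fold (l' i) in H2.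
    assert (Hterm : forall k, (k < m)%nat -> e k * (l k / l' k + l' k / l k - 2) =
              e k / (l k * l' k) * ((l k - l' k) * (l k - l' k))).
    { intros k Hk. pose proof (limitPoint_bundleCost q k Hq Hk) as H3. fold (l k) in H3.
      pose proof (limitPoint_bundleCost q' k Hq' Hk) as H4. fold (l' k) in H4. field. lra. }
    assert (Hcoef : forall k, (k < m)%nat -> 0 < e k / (l k * l' k)).
    { intros k Hk. apply Rdiv_lt_0_compat; auto. apply Rmult_lt_0_compat; now apply limitPoint_bundleCost. }
    assert (E : e i * (l i / l' i + l' i / l i - 2) = 0).
    { apply (rsum_nonneg_eq0 m (fun i => e i * (l i / l' i + l' i / l i - 2))); auto; [|lra].
      intros k Hk. rewrite Hterm by auto. apply Rmult_le_pos; [left; auto|apply Rle_0_sqr]. }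
    rewrite Hterm in E by auto. specialize (Hcoef i Hi).
    apply Rmult_integral in E as [E|E]; [lra|]. apply Rmult_integral in E. lra. }
  apply rsum_ext. intros i Hi. unfold leontief_demand.
  specialize (Hel i Hi). unfold l, l' in Hel. now rewrite Hel.
Qed.

(* Demand for [j] cannot stay above level [a] forever, and prices move slowly, so a limit point with
   demand above [a] forces infinitely many down-crossings of [a] and hence a limit point at [a]. *)
Lemma intermediate_limitPoint q j a : limitPoint q -> (j < n)%nat -> 1 < a < fixedDemand q j ->
  exists q', limitPoint q' /\ fixedDemand q' j = a.
Proof.
  intros Hq Hj Ha.
  set (Q := fun N => a < totalDemand (price N) j /\ totalDemand (price (S N)) j <= a).
  assert (HQ : infinitelyOften Q).
  { intros N0. apply NNPP. intros Hno.
    destruct (tendsAt_fixedDemand q j Hq (fixedDemand q j - a) ltac:(lra)) as [d [Hd H]].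
    destruct (Hq d Hd N0) as (N & HN & Hcl). specialize (H _ Hcl).
    rewrite <- totalDemand_fixed in H by auto. apply Rabs_def2 in H.
    assert (Hall : forall M, (N <= M)%nat -> a < totalDemand (price M) j).
    { induction 1 as [|M HM IH]; [lra|]. apply Rnot_le_lt. intros Hle. apply Hno.
      exists M. split; [lia|]. now split. }
    apply (no_persistent_excess j (a - 1) N Hj ltac:(lra)).
    intros M HM. specialize (Hall M HM). lra. }
  destruct (limitPoint_exists Q HQ) as [q' Hq'].
  assert (Hlq' : limitPoint q').
  { intros d Hd N0. destruct (Hq' d Hd N0) as (N & H1 & _ & H2). eauto. }
  exists q'. split; auto. apply Rle_antisym; apply Rnot_lt_le; intros Hlt.
  (* [q'] is a cluster point of the prices just before the crossings; slow drift makes it one of the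
     prices just after, where demand is at most [a]. *)
  - destruct (tendsAt_fixedDemand q' j Hlq' (fixedDemand q' j - a) ltac:(lra)) as [d [Hd H]].
    destruct (drift_small (d / 2) 1 ltac:(lra) ltac:(lra)) as [N0 HN0].
    destruct (Hq' (d / 2) ltac:(lra) N0) as (N & HN & [_ HX] & Hcl).
    assert (Hcl' : closeTo n d (price (S N)) q').
    { intros l Hl. pose proof (eventTime_S_le N).
      pose proof (HN0 N (S N) ltac:(lia) ltac:(lra) l Hl) as H1. specialize (Hcl l Hl).
      replace (price (S N) l - q' l) with ((price (S N) l - price N l) + (price N l - q' l)) by ring.
      eapply Rle_lt_trans; [apply Rabs_triang|lra]. }
    specialize (H _ Hcl'). rewrite <- totalDemand_fixed in H by auto. apply Rabs_def2 in H. lra.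
  - destruct (tendsAt_fixedDemand q' j Hlq' (a - fixedDemand q' j) ltac:(lra)) as [d [Hd H]].
    destruct (Hq' d Hd 0%nat) as (N & _ & [HX _] & Hcl).
    specialize (H _ Hcl). rewrite <- totalDemand_fixed in H by auto. apply Rabs_def2 in H. lra.
Qed.

Lemma limitPoint_no_excess q j : limitPoint q -> (j < n)%nat -> fixedDemand q j <= 1.
Proof.
  intros Hq Hj. apply Rnot_lt_le. intros Hlt.
  (* Infinitely many distinct levels strictly between 1 and the demand at [q]. Two of the resulting
     limit points share their support, hence their demand, although their levels differ. *)
  set (a := fun r : nat => 1 + (fixedDemand q j - 1) * / (INR r + 2)).
  assert (Ha : forall r, 1 < a r < fixedDemand q j).
  { intros r. unfold a. pose proof (pos_INR r).
    assert (0 < / (INR r + 2) < 1).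
    { split; [apply Rinv_0_lt_compat; lra|]. rewrite <- Rinv_1. apply Rinv_lt_contravar; lra. }
    split; nra. }
  set (s := fun r => proj1_sig (constructive_indefinite_description _
              (intermediate_limitPoint q j (a r) Hq Hj (Ha r)))).
  assert (Hs : forall r, limitPoint (s r) /\ fixedDemand (s r) j = a r).
  { intros r. unfold s. now destruct (constructive_indefinite_description _ _). }
  destruct (infinite_pigeonhole n (fun r l => 0 < s r l)) as [Q [HQ Hsup]].
  destruct (HQ 0%nat) as (r & _ & Hr). destruct (HQ (S r)) as (r' & Hrr & Hr').
  destruct (Hs r) as [L1 E1]. destruct (Hs r') as [L2 E2].
  pose proof (limitPoint_support_demand (s r) (s r') j L1 L2 (Hsup r r' Hr Hr')) as E.
  rewrite E1, E2 in E. unfold a in E.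
  assert (Hlt' : INR r < INR r') by (apply lt_INR; lia). pose proof (pos_INR r).
  assert (/ (INR r' + 2) < / (INR r + 2)) by (apply Rinv_lt_contravar; [apply Rmult_lt_0_compat|]; lra).
  nra.
Qed.

Theorem limit_points_zero_elasticity q :
  (forall eps, 0 < eps -> forall T0, exists t, T0 <= t /\
     forall j, (j < n)%nat -> Rabs (p t j - q j) < eps) ->
  (forall j, (j < n)%nat -> 0 <= q j) /\
  (forall i, (i < m)%nat -> 0 < bundleCost n (w i) q) /\
  (forall j, (j < n)%nat -> (0 < q j -> fixedDemand q j = 1) /\ fixedDemand q j <= 1).
Proof.
  intros H. assert (Hq : limitPoint q).
  { intros eps Heps N0. pose proof (eventTime_pos N0).
    destruct (H eps Heps (eventTime N0 + 1)) as (t & Ht & Hc').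
    destruct (price_of_time t ltac:(lra)) as (M & HM & _ & Hp). exists M. split.
    - apply Nat.nlt_ge. intros Hlt. pose proof (eventTime_mono M N0 ltac:(lia)). lra.
    - intros l Hl. rewrite <- Hp; auto. }
  split; [intros; now apply limitPoint_nonneg|].
  split; [intros; now apply limitPoint_bundleCost|].
  intros j Hj. split; [now apply limitPoint_clears_fixed|now apply limitPoint_no_excess].
Qed.
End ZeroElasticity.

End Tatonnement.

(** * Reduction of both kinds of market to the common form of demand *)

Lemma IsDemand_ext n u u' e q x : (forall y, u y = u' y) -> IsDemand n u e q x -> IsDemand n u' e q x.
Proof.
  intros H (H1 & H2 & H3). split; [auto|]. split; [auto|].
  intros y Hy Hc. rewrite <- !H. auto.
Qed.

Lemma excess_totalDemand n m D e w c q j :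
  (forall i, (i < m)%nat -> D i q j = demand n (w i) (c i) (e i) q j) ->
  excess m D q j = totalDemand n m e w c q j - 1.
Proof. intros H. unfold excess, totalDemand. f_equal. now apply rsum_ext. Qed.

Theorem mainTheorem6
  (n m : nat) (e : nat -> R) (u : nat -> (nat -> R) -> R)
  (D : nat -> (nat -> R) -> nat -> R)
  (lambda : R) (T : nat -> nat -> R) (P : nat -> nat -> R)
  (zt : nat -> nat -> R) (p : R -> nat -> R)
  (Hlam : 0 < lambda /\ lambda <= 100 / 2346)
  (He : forall i, (i < m)%nat -> 0 < e i)
  (Hdemand : forall i, (i < m)%nat -> forall q : nat -> R,
       (forall j, (j < n)%nat -> 0 < q j) -> IsDemand n (u i) (e i) q (D i q))
  (Hinit : forall j, (j < n)%nat -> 0 < P j O)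
  (Htimes : forall j, (j < n)%nat ->
       (0 < T j O <= 1) /\
       (forall k, T j k < T j (S k) <= T j k + 1) /\
       (forall M, exists k, M < T j k))
  (Hdistinct : forall j j' k k', (j < n)%nat -> (j' < n)%nat ->
       T j k = T j' k' -> j = j' /\ k = k')
  (Htraj : forall j, (j < n)%nat ->
       (forall t, 0 <= t <= T j O -> p t j = P j O) /\
       (forall k t, T j k < t <= T j (S k) -> p t j = P j (S k)))
  (Hzt : forall j k, (j < n)%nat ->
       exists t1 t2,
         prev_time T j k < t1 <= T j k /\ prev_time T j k < t2 <= T j k /\
         excess m D (p t1) j <= zt j k <= excess m D (p t2) j)
  (Hupdate : forall j k, (j < n)%nat ->
       P j (S k) = P j k * (1 + lambda * Rmin (zt j k) 1 * (T j k - prev_time T j k))) :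
  ((exists (a : nat -> nat -> R) (rho : nat -> R),
      forall i, (i < m)%nat ->
        rho i <= 0 /\ (forall j, (j < n)%nat -> 0 <= a i j) /\
        (exists j, (j < n)%nat /\ 0 < a i j) /\
        (forall x, u i x = ces_util n (a i) (rho i) x)) ->
    exists pstar : nat -> R,
      IsEquilibrium n m e u pstar /\
      (forall eps, 0 < eps -> exists T0, forall t, T0 <= t ->
         forall j, (j < n)%nat -> Rabs (p t j - pstar j) < eps))
  /\
  ((exists (Sl : nat -> nat -> bool) (b : nat -> nat -> R),
      forall i, (i < m)%nat ->
        (exists j, (j < n)%nat /\ Sl i j = true) /\
        (forall j, (j < n)%nat -> Sl i j = true -> 0 < b i j) /\
        (forall x, u i x = leontief_util n (Sl i) (b i) x)) ->
    forall q : nat -> R,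
      (forall eps, 0 < eps -> forall T0, exists t, T0 <= t /\
         forall j, (j < n)%nat -> Rabs (p t j - q j) < eps) ->
      IsEquilibrium n m e u q).
Proof.
  (* Conditional on positive prices, where uniqueness of demand identifies [D] with the formula. *)
  assert (Hz : forall w c,
    (forall i, (i < m)%nat -> forall q, (forall j, (j < n)%nat -> 0 < q j) ->
       forall j, (j < n)%nat -> D i q j = demand n (w i) (c i) (e i) q j) ->
    forall j k, (j < n)%nat -> exists t1 t2,
         prev_time T j k < t1 <= T j k /\ prev_time T j k < t2 <= T j k /\
         ((forall l, (l < n)%nat -> 0 < p t1 l) -> (forall l, (l < n)%nat -> 0 < p t2 l) ->
          totalDemand n m e w c (p t1) j - 1 <= zt j k <= totalDemand n m e w c (p t2) j - 1)).
  { intros w c HD j k Hj. destruct (Hzt j k Hj) as (t1 & t2 & H1 & H2 & H3).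
    exists t1, t2. split; [auto|]. split; [auto|]. intros P1 P2.
    rewrite <- !(excess_totalDemand n m D e w c); auto. }
  (* Merging the updates requires a good. Without goods there are no buyers either, since each wants
     some good. *)
  destruct (Nat.eq_0_gt_0_cases n) as [Hn|Hn].
  { subst n. split.
    - intros [a [rho Ha]]. exists (fun _ => 0). split; [|intros; exists 0; intros; lia].
      split; [intros; lia|]. exists (fun _ _ => 0). split; [|intros; lia].
      intros i Hi. destruct (Ha i Hi) as (_ & _ & [j [Hj _]] & _). lia.
    - intros [Sl [b Hb]] q _. split; [intros; lia|]. exists (fun _ _ => 0).
      split; [|intros; lia].
      intros i Hi. destruct (Hb i Hi) as ([j [Hj _]] & _). lia. }
  split.
  - intros [a [rho Ha]].
    set (w := fun i => ces_weight (a i) (rho i)).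
    set (c := fun i => ces_exponent (rho i)).
    assert (Hc : forall i, (i < m)%nat -> 0 < c i <= 1)
      by (intros i Hi; now apply ces_exponent_range, Ha).
    assert (HD : forall i, (i < m)%nat -> forall q, (forall j, (j < n)%nat -> 0 < q j) ->
       forall j, (j < n)%nat -> D i q j = demand n (w i) (c i) (e i) q j).
    { intros i Hi q Hq. destruct (Ha i Hi) as (H1 & _ & H3 & H4).
      apply ces_demand_unique; auto. apply (IsDemand_ext n (u i)); auto. }
    destruct (convergence_positive_elasticity n m e w c lambda T P zt p Hn Hlam He
      (fun i Hi => conj (Rlt_le _ _ (proj1 (Hc i Hi))) (proj2 (Hc i Hi)))
      (fun i _ j _ => ces_weight_nonneg (a i) (rho i) j)
      (fun i Hi => ces_weight_exists n (a i) (rho i) (proj1 (proj2 (proj2 (Ha i Hi)))))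
      Hinit Htimes Hdistinct Htraj (Hz w c HD) Hupdate (fun i Hi => proj1 (Hc i Hi)))
      as (q & Hq0 & Hqw & Hq & Hconv).
    exists q. split; [|exact Hconv]. split; [exact Hq0|].
    (* The allocation comes from the formula and not from [D], which is unconstrained where [q] has
       zero prices. *)
    exists (fun i => demand n (w i) (c i) (e i) q). split.
    + intros i Hi. destruct (Ha i Hi) as (H1 & _ & H3 & H4).
      apply (IsDemand_ext n (ces_util n (a i) (rho i))); [auto|].
      apply ces_demand_optimal; auto. now apply Hqw.
    + intros j Hj. destruct (Hq j Hj) as [H1 H2]. fold (totalDemand n m e w c q j).
      split; intros H; [rewrite H1 by auto|rewrite H2 by auto]; lra.
  - intros [Sl [b Hb]] q Hlim.
    set (w := fun i => leontief_weight (Sl i) (b i)).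
    assert (HD : forall i, (i < m)%nat -> forall q, (forall j, (j < n)%nat -> 0 < q j) ->
       forall j, (j < n)%nat -> D i q j = demand n (w i) 0 (e i) q j).
    { intros i Hi r Hr j Hj. destruct (Hb i Hi) as (H1 & H2 & H3).
      rewrite <- leontief_demand_eq by auto.
      apply leontief_demand_unique; auto. apply (IsDemand_ext n (u i)); auto. }
    destruct (limit_points_zero_elasticity n m e w (fun _ => 0) lambda T P zt p Hn Hlam He
      ltac:(intros; lra)
      (fun i Hi => leontief_weight_nonneg n (Sl i) (b i) (proj1 (proj2 (Hb i Hi))))
      (fun i Hi => leontief_weight_exists n (Sl i) (b i) (proj1 (Hb i Hi)) (proj1 (proj2 (Hb i Hi))))
      Hinit Htimes Hdistinct Htraj (Hz w (fun _ => 0) HD) Hupdate ltac:(auto) q Hlim)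
      as (Hq0 & Hqb & Hq).
    split; [exact Hq0|].
    exists (fun i => leontief_demand n (e i) (w i) q). split.
    + intros i Hi. destruct (Hb i Hi) as (H1 & H2 & H3).
      apply (IsDemand_ext n (leontief_util n (Sl i) (b i))); [auto|].
      apply leontief_demand_optimal; auto. now apply Hqb.
    + intros j Hj. destruct (Hq j Hj) as [H1 H2]. fold (fixedDemand n m e w q j).
      split; intros H; [rewrite H1 by auto; lra|lra].
Qed.
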